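(* Let $f_0:[-1,1]\to\mathbb{R}$ be nondecreasing and continuous at $0$. For each $n$ and each nondecreasing $f:[-1,1]\to\mathbb R$, let $\mathbb{P}_f$ be the law under which one observes $Y_i=f(x_i)+\varepsilon_i$, $x_i=i/n$ $(i=-n,\dots,n)$, where the $\varepsilon_i$ are i.i.d. with mean zero, $\mathrm{Var}(\varepsilon_i)=\sigma^2<\infty$, and a density $\phi$ with respect to Lebesgue measure for which there exists $M>0$ with $$\int_{-\infty}^\infty\big(\phi^{1/2}(y-a)-\phi^{1/2}(y)\big)^2\,dy\le Ma^2\qquad\text{for all }a\in\mathbb{R}.$$ Let $\hat f$ be the monotone least squares estimator (defined in the context). Choose $\alpha\in(0,1)$ and $\beta\in(0,1/2)$. There exists $\eta>0$ such that for all $n$ large enough we can find a nondecreasing function $f_1=f_{1,n}$ on $[-1,1]$ and a rate $\gamma_n>0$ with $$\limsup_{n\to\infty}\ \max_{i=0,1}\ \mathbb{P}_{f_i}\big(|\hat f(0)-f_i(0)|\ge\gamma_n\big)\le\alpha$$ and $$\liminf_{n\to\infty}\ \inf_{\hat\theta}\ \max_{i=0,1}\ \mathbb{P}_{f_i}\big(|\hat\theta(Y)-f_i(0)|\ge\eta\cdot\gamma_n\big)>\beta,$$ where the infimum is over all estimators $\hat\theta(Y)$ of $f(0)$, i.e. all real-valued measurable functions of the data $Y=(Y_{-n},\dots,Y_n)$.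
   Context: Estimator: with $x_{-n-1}=-1-1/n$, set $\hat g(t)=\sum_{i=-n}^nY_i1_{\{x_{i-1}<t\le x_i\}}$, $\hat G(s)=\int_0^s\hat g(t)\,dt$ for $s\in[-1-1/n,1]$, $\hat F(t)=\sup\{\phi(t):\phi\text{ affine and }\phi(s)\le\hat G(s)\ \forall\,s\in[-1-1/n,1]\}$, and $\hat f(t)=\lim_{h\downarrow0}(\hat F(t)-\hat F(t-h))/h$. The function $f_1$ may depend on $n$; $\eta$ does not. *)

(* Defs.v *)
From HB Require Import structures.
From mathcomp Require Import all_boot all_order all_algebra.
From mathcomp Require Import all_classical all_reals all_analysis.
From mathcomp Require Import measurable_realfun.

Set Implicit Arguments.
Unset Strict Implicit.
Unset Printing Implicit Defensive.

Import Order.TTheory GRing.Theory Num.Theory.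
Import numFieldNormedType.Exports.

Local Open Scope classical_set_scope.
Local Open Scope ring_scope.

Section iid.
Context d (T : measurableType d) (R : realType).
Implicit Types (mu : probability T R) (m : nat).

Definition cons_pair m (p : T * m.-tuple T) : m.+1.-tuple T :=
  [tuple of p.1 :: p.2].

Lemma measurable_cons_pair m :
  measurable_fun [set: T * m.-tuple T] (@cons_pair m).
Proof. exact: measurable_cons. Qed.

HB.instance Definition _ m :=
  isMeasurableFun.Build _ _ _ _ (@cons_pair m) (@measurable_cons_pair m).

(* The m-fold product of mu, i.e., the joint law of m i.i.d. variables with
   law mu; iid_law_box is the characteristic property. *)
Fixpoint iid_law mu m : probability (m.-tuple T) R :=
  match m with
  | 0 => \d_[tuple]
  | m'.+1 => distribution (mu \x iid_law mu m')%E (@cons_pair m')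
  end.

Lemma measurable_box m (A : 'I_m -> set T) : (forall i, measurable (A i)) ->
  measurable [set y : m.-tuple T | forall i, A i (tnth y i)].
Proof.
move=> mA; pose F (i : 'I_m) := (@tnth m T ^~ i) @^-1` A i.
rewrite (_ : [set _ | _] = \bigcap_(i in [set: 'I_m]) F i); last first.
  by apply/seteqP; split => [y yA i _|y yA i]; [exact: yA|exact: (yA i)].
apply: fin_bigcap_measurable => // i _.
by rewrite -[F i]setTI; exact: measurable_tnth.
Qed.

Lemma iid_law_box mu m (A : 'I_m -> set T) : (forall i, measurable (A i)) ->
  iid_law mu m [set y | forall i, A i (tnth y i)] = (\prod_(i < m) mu (A i))%E.
Proof.
elim: m A => [|m IH] A mA.
  by rewrite big_ord0 /= diracE mem_set// => -[].
rewrite big_ord_recl -IH; last by move=> i; exact: mA.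
have mB := measurable_box (fun i => mA (lift ord0 i)).
rewrite -(product_measure1E mu (iid_law mu m) (mA ord0) mB).
congr ((_ \x _)%E _); apply/seteqP; split => -[x y] /=.
- move=> yA; split => [|i]; first by have := yA ord0; rewrite tnth0.
  by have := yA (lift ord0 i); rewrite tnthS.
- move=> [xA yA] i; case: (unliftP ord0 i) => [j|] ->.
  + by rewrite tnthS; exact: yA.
  + by rewrite tnth0.
Qed.

End iid.

Definition has_density (R : realType) (mu : probability R R) (phi : R -> R) :=
  [/\ measurable_fun [set: R] phi,
      forall y, 0 <= phi y &
      forall A : set R, measurable A ->
        mu A = (\int[@lebesgue_measure R]_(y in A) (phi y)%:E)%E].

Section model.
Context {R : realType}.

(* A sample indexed by the integers -n, ..., n is stored as a tuple of length
   2n+1 whose entry number j carries the integer index j - n. *)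
Definition sample_index n (j : 'I_n.*2.+1) : int := j%:Z - n%:Z.

Definition design n (k : int) : R := k%:~R / n%:R.

Definition observe n (f : R -> R) (e : n.*2.+1.-tuple R) : n.*2.+1.-tuple R :=
  [tuple f (design n (sample_index j)) + tnth e j | j < n.*2.+1].

Lemma measurable_observe n f :
  measurable_fun [set: n.*2.+1.-tuple R] (@observe n f).
Proof.
apply/measurable_fun_tnthP => j.
rewrite (_ : _ \o _ = fun e : n.*2.+1.-tuple R =>
    f (design n (sample_index j)) + tnth e j); last first.
  by apply/funext => e /=; rewrite tnth_mktuple.
by apply: measurable_funD => //; exact: measurable_tnth.
Qed.

HB.instance Definition _ n f :=
  isMeasurableFun.Build _ _ _ _ (@observe n f) (@measurable_observe n f).

(* The law P_f of the data, for i.i.d. errors with law mu. *)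
Definition data_law (mu : probability R R) n (f : R -> R) :
    probability (n.*2.+1.-tuple R) R :=
  distribution (iid_law mu n.*2.+1) (@observe n f).

End model.

Section monotone_lse.
Context {R : realType} (n : nat) (y : n.*2.+1.-tuple R).

(* design n k equals k / n, so the left end point for the smallest index is
   design n (- n - 1) = -1 - 1/n. *)
Definition ghat (t : R) : R :=
  \sum_(j < n.*2.+1) tnth y j *
    \1_`]design n (sample_index j - 1), design n (sample_index j)] t.

Definition Ghat (s : R) : R :=
  if 0 <= s then \int[lebesgue_measure]_(t in `[0, s]) ghat t
  else - \int[lebesgue_measure]_(t in `[s, 0]) ghat t.

Definition affine (phi : R -> R) := exists a b, forall t, phi t = a * t + b.

Definition Fhat (t : R) : R :=
  sup [set phi t | phi in [set phi | affine phi /\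
    forall s, s \in `[-1 - n%:R^-1, 1] -> phi s <= Ghat s]].

Definition fhat (t : R) : R :=
  lim ((Fhat t - Fhat (t - h)) / h @[h --> 0^'+]).

End monotone_lse.

Definition max_error_prob (R : realType) (mu : probability R R) n
    (f0 f1 : R -> R) (theta : n.*2.+1.-tuple R -> R) (r : R) : \bar R :=
  maxe (data_law mu n f0 [set y | r <= `|theta y - f0 0|])
       (data_law mu n f1 [set y | r <= `|theta y - f1 0|]).

(* Main.v *)
Require Import Defs.
From HB Require Import structures.
From mathcomp Require Import all_boot all_order all_algebra.
From mathcomp Require Import all_classical all_reals all_analysis.
From mathcomp Require Import measurable_realfun ring lra zify.
Import Order.TTheory GRing.Theory Num.Theory.
Import numFieldNormedType.Exports.
Local Open Scope classical_set_scope.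
Local Open Scope ring_scope.

(** Why the theorem holds.

    The estimator at 0 is the slope of the greatest convex minorant of the
    cumulated data over the cell that ends at 0.  The line that carries this
    piece of the minorant touches the cumulated data at some knot j on the left
    of 0 and at some knot l on its right ([supporting_chord]), so the slope is a
    saddle value of the block means of the data ([fhat_saddle]):
      fhat 0 = max_j min_l (mean over the block from j to l).
    Fixing one end of the blocks therefore bounds the error on one side:
    fhat 0 >= c forces some block with a prescribed right end to have mean at
    least c, and symmetrically on the left.  If N design points lie between 0 and
    the prescribed end, both included, all these blocks contain N points at
    least, and a maximal inequality of Hajek-Renyi type ([maximal_inequality],
    [long_average_bound]) bounds all the noise means at once by C / sqrt N,
    outside an event of probability 2 sigma^2 / C^2.  So the error exceeds
      (variation of f up to the prescribed end) + C / sqrt N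
    only with small probability, on either side ([fhat_error_bound]).

    Let u be the larger of the two minima, one for each side, of this bound
    for f0 over the prescribed end; suppose it is the one on the right.  Put
    gamma = 2 u, delta = c u with c a small constant, and
      f1 = max (f0, f0 0 + delta) on the right of 0, f1 = f0 on the left.
    The bounds for f1 exceed those for f0 by delta at most, hence stay below
    gamma.  At a point q / n where f1 and f0 differ, f0 (q / n) - f0 0 < delta,
    while u is at most f0 (q / n) - f0 0 + C / sqrt (q + 1); thus
    (1 - c) u < C / sqrt (q + 1), which leaves 4 C^2 / u^2 such points at most.
    The squared distance between f0 and f1 on the design is then bounded by
    4 c^2 C^2, whatever n and f0 are ([upward_alternative]); the mirror image
    settles the other case ([exists_hard_alternative]).

    The Hellinger condition makes the affinity of the two laws of the data at
    least 1 - (M / 2) * (squared distance) ([product_affinity_ge]).  For c small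
    this is so close to 1 that every test between the two laws has a sum of
    errors close to 1 ([testing_error_ge]).  As |f1 0 - f0 0| = c gamma / 2, an
    estimator that is within c gamma / 4 of the truth under both laws with
    large probability would give a better test ([two_point_bound]). *)

Set Implicit Arguments.
Unset Strict Implicit.
Unset Printing Implicit Defensive.

(** * Densities and translations *)

Section density.
Context {R : realType}.
Variables (mu : probability R R) (phi : R -> R).
Hypothesis mu_density : has_density mu phi.
Local Open Scope ereal_scope.
Notation leb := (@lebesgue_measure R).

Let mphi : measurable_fun [set: R] phi. Proof. by case: mu_density. Qed.
Let phi_ge0 y : (0 <= phi y)%R. Proof. by case: mu_density. Qed.

Import HBNNSimple.

(** The density formula is assumed for sets, i.e., for indicators; it passes to
    simple functions by linearity and to nonnegative functions by monotone
    convergence. *)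
Lemma ge0_integral_density (f : R -> \bar R) :
  measurable_fun [set: R] f -> (forall x, 0 <= f x) ->
  \int[mu]_x f x = \int[leb]_x (f x * (phi x)%:E).
Proof.
move=> mf f0.
have mphiE : measurable_fun [set: R] (EFin \o phi) by exact/measurable_EFinP.
have indic (E : set R) : measurable E ->
    \int[mu]_x (\1_E x)%:E = \int[leb]_x ((\1_E x)%:E * (phi x)%:E).
  move=> mE; case: mu_density => _ _ dens; rewrite integral_indic// setIT.
  apply: (eq_trans (dens E mE)).
  rewrite integral_mkcond; apply: eq_integral => x _.
  by rewrite patchE indicE; case: ifPn => _; rewrite ?mul1e ?mul0e.
pose f_ := nnsfun_approx measurableT mf.
have mf_ n : measurable_fun [set: R] (fun x : R => (f_ n x)%:E).
  by apply/measurable_EFinP.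
have simple n : \int[mu]_x (f_ n x)%:E
              = \int[leb]_x ((f_ n x)%:E * (phi x)%:E).
  have mterm r : measurable_fun [set: R]
      (fun x : R => (r * \1_(f_ n @^-1` [set r]) x)%:E).
    by apply/measurable_EFinP; exact: measurable_funM.
  have mindic r : measurable_fun [set: R]
      (fun x : R => (\1_(f_ n @^-1` [set r]) x)%:E).
    by apply/measurable_EFinP; exact: measurable_indic.
  under [LHS]eq_integral do rewrite fimfunE -fsumEFin//.
  rewrite [LHS]ge0_integral_fsum//; last first.
    by move=> k x _; rewrite EFinM nnfun_muleindic_ge0.
  under [RHS]eq_integral.
    move=> x _; rewrite fimfunE -fsumEFin// muleC ge0_mule_fsumr; last first.
      by move=> r; rewrite EFinM nnfun_muleindic_ge0.
    over.
  rewrite [RHS]ge0_integral_fsum//; last 2 first.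
  - by move=> r; apply: emeasurable_funM; [exact: mphiE|exact: mterm].
  - move=> k x _; rewrite mule_ge0//; last by rewrite EFinM nnfun_muleindic_ge0.
    by rewrite lee_fin.
  apply: eq_fsbigr => r _; rewrite integralZl_indic_nnsfun// indic//.
  have [r0|r0] := ltP r 0%R.
    rewrite (preimage_nnfun0 _ r0) [X in _ * X = _]integral0_eq; last first.
      by move=> x _; rewrite indic0 mul0e.
    by rewrite mule0 integral0_eq// => x _; rewrite indic0 mulr0 mule0.
  rewrite -ge0_integralZl//=.
  - by apply: eq_integral => x _; rewrite EFinM muleA [RHS]muleC.
  - by apply: emeasurable_funM; [exact: mindic|exact: mphiE].
  - by move=> x _; rewrite mule_ge0// lee_fin.
transitivity (lim (\int[mu]_x (f_ n x)%:E @[n --> \oo])).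
  rewrite -monotone_convergence//=.
  - apply: eq_integral => x _; apply/esym/cvg_lim => //=.
    exact: cvg_nnsfun_approx.
  - by move=> n ? _; rewrite lee_fin.
  - by move=> ? _ ? ? mn; rewrite lee_fin; exact/lefP/nd_nnsfun_approx.
rewrite (_ : (fun n => _) = fun n => \int[leb]_x ((f_ n x)%:E * (phi x)%:E));
  last exact/funext.
rewrite -monotone_convergence//=.
- apply: eq_integral => x _; apply/cvg_lim => //=.
  apply: cvgeZr => //; exact: cvg_nnsfun_approx.
- by move=> n; apply: emeasurable_funM; [exact: mf_|exact: mphiE].
- by move=> n x _; rewrite mule_ge0// lee_fin.
- move=> x _ m n mn; apply: lee_wpmul2r; rewrite lee_fin//.
  by have /lefP := nd_nnsfun_approx measurableT mf mn; exact.
Qed.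

End density.

Section translation.
Context {R : realType}.
Local Open Scope ereal_scope.
Notation leb := (@lebesgue_measure R).

Definition translate (d x : R) : R := x + d.

Lemma measurable_translate (d : R) : measurable_fun [set: R] (translate d).
Proof. exact: measurable_funD. Qed.

(** Both measures agree on half-open intervals, which determine a measure on the
    Borel sets. *)
Lemma lebesgue_measure_translate (d : R) (A : set R) : measurable A ->
  pushforward leb (translate d : _ -> measurableTypeR R) A = leb A.
Proof.
move=> mA; apply/esym/lebesgue_measure_unique => //=.
- exact: measurable_translate.
- move=> ? _ [[a b]] ab <-.
rewrite {1}/pushforward (_ : _ @^-1` _ = `](a - d)%R, (b - d)%R]%classic).
  rewrite !lebesgue_measure_itv/= !lte_fin ltrD2r; case: ifP => // _.
  by rewrite -!EFinB; congr (_%:E); ring.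
by apply/seteqP; split => x /=; rewrite /translate/= !in_itv/= ltrBlDr lerBrDr.
Qed.

Lemma ge0_integral_translate (d : R) (f : R -> \bar R) :
  measurable_fun [set: R] f -> (forall x, 0 <= f x) ->
  \int[leb]_x f (translate d x) = \int[leb]_x f x.
Proof.
move=> mf f0; rewrite -[RHS](_ : \int[pushforward leb
    (translate d : _ -> measurableTypeR R)]_x f x = _).
  by rewrite ge0_integral_pushforward//=; exact: measurable_translate.
apply: eq_measure_integral => [|mT A mA _]; first exact: measurable_translate.
exact: lebesgue_measure_translate.
Qed.

End translation.

(** * Independent samples *)

Section iid_facts.
Context d (T : measurableType d) (R : realType) (mu : probability T R).
Local Open Scope ereal_scope.

(** Boxes form a generating class closed under intersection: probability laws on
    tuples that agree on boxes are equal. *)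
Definition boxes m : set (set (m.-tuple T)) :=
  [set B | exists2 A : 'I_m -> set T, (forall i, measurable (A i)) &
           B = [set y | forall i, A i (tnth y i)]].

Arguments boxes m : clear implicits.

Lemma measurable_boxes m : @measurable _ (m.-tuple T) = <<s boxes m >>.
Proof.
apply/seteqP; split; last first.
  apply: smallest_sub; first exact: sigma_algebra_measurable.
  by move=> _ [A mA ->]; exact: measurable_box.
apply: smallest_sub; first exact: smallest_sigma_algebra.
move=> B; rewrite -bigcup_seq => -[i _ [A mA <-]].
apply: sub_sigma_algebra; exists (fun j => if j == i then A else setT).
  by move=> j; case: ifP.
apply/seteqP; split => y /=.
  by move=> [_ Ay] j; case: eqP => [->|].
by move=> /(_ i); rewrite eqxx.
Qed.

Lemma setI_closed_boxes m : setI_closed (boxes m).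
Proof.
move=> _ _ [A mA ->] [B mB ->]; exists (fun i => A i `&` B i).
  by move=> i; exact: measurableI.
apply/seteqP; split => y /=; first by move=> [Ay By] i.
by move=> h; split => i; case: (h i).
Qed.

Definition sub_sample m M (p : 'I_m -> 'I_M) (e : M.-tuple T) : m.-tuple T :=
  [tuple tnth e (p j) | j < m].

Lemma measurable_sub_sample m M (p : 'I_m -> 'I_M) :
  measurable_fun [set: M.-tuple T] (sub_sample p).
Proof.
apply/measurable_fun_tnthP => j.
rewrite (_ : _ \o _ = fun e : M.-tuple T => tnth e (p j)).
  exact: measurable_tnth.
by apply/funext => e /=; rewrite tnth_mktuple.
Qed.

HB.instance Definition _ m M (p : 'I_m -> 'I_M) :=
  isMeasurableFun.Build _ _ _ _ (sub_sample p) (@measurable_sub_sample m M p).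

(** Any selection of distinct coordinates of an i.i.d. sample, in any order, is
    again an i.i.d. sample.  This allows partial sums to be formed leftwards or
    rightwards from any point of the design, whereas [iid_law] only exposes its
    first coordinate.  It suffices to compare the laws on boxes: the coordinates
    that are not selected contribute factors 1. *)
Lemma iid_law_sub_sample m M (p : 'I_m -> 'I_M) (B : set (m.-tuple T)) :
  injective p -> measurable B ->
  iid_law mu M (sub_sample p @^-1` B) = iid_law mu m B.
Proof.
move=> p_inj mB.
have boxT k : boxes k setT.
  by exists (fun=> setT) => //; apply/seteqP; split.
apply: (measure_unique (boxes m) (fun=> setT) (measurable_boxes m)
  (@setI_closed_boxes m) (fun=> boxT m) _
  (distribution (iid_law mu M) (sub_sample p)) (iid_law mu m)) => //.
- by apply/seteqP; split => // x _; exists 0%N.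
- move=> _ [A mA ->].
  apply: eq_trans (esym (iid_law_box mu mA)).
  pose A' i := if [pick j | p j == i] is Some j then A j else setT.
  have A'p j : A' (p j) = A j.
    rewrite /A'; case: pickP => [k /eqP/p_inj -> //|/(_ j)].
    by rewrite eqxx.
  have A'T i : i \notin codom p -> A' i = setT.
    rewrite /A'; case: pickP => // k /eqP <-.
    by rewrite codom_f.
  transitivity (iid_law mu M [set e | forall i, A' i (tnth e i)]).
    congr (iid_law mu M _); apply/seteqP; split => e /= h i.
      have [/codomP[j ->]|/A'T ->//] := boolP (i \in codom p).
      by rewrite A'p; have := h j; rewrite tnth_mktuple.
    by rewrite tnth_mktuple -A'p.
  have mA' i : measurable (A' i) by rewrite /A'; case: pickP.
  apply: (eq_trans (iid_law_box mu mA')).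
  rewrite (bigID (mem (codom p)))/= [X in _ * X]big1 ?mule1; last first.
    by move=> i /A'T ->; rewrite probability_setT.
  rewrite (reindex_omap p (fun i => [pick j | p j == i])); last first.
    move=> i /codomP[j ->]; case: pickP => [k /eqP/p_inj -> //|/(_ j)].
    by rewrite eqxx.
  apply: eq_big => [j|j _]; last by rewrite A'p.
  rewrite codom_f/=; case: pickP => [k /eqP/p_inj -> |/(_ j)]; by rewrite eqxx.
- by move=> _; rewrite (le_lt_trans (probability_le1 _ _))// ltry.
Qed.

(** Conditioning on the first observation: the basis of the two inductions on the
    sample size below. *)
Lemma iid_lawS m (B : set (m.+1.-tuple T)) :
  iid_law mu m.+1 B = \int[mu]_x iid_law mu m [set e | B (cons_pair (x, e))].
Proof.
rewrite /= /distribution/pushforward/product_measure1.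
apply: eq_integral => x _ /=; congr (iid_law mu m _).
by apply/seteqP; split => e /=; rewrite /xsection/= inE.
Qed.

Lemma measurable_section m (B : set (m.+1.-tuple T)) : measurable B ->
  forall x, measurable [set e : m.-tuple T | B (cons_pair (x, e))].
Proof.
move=> mB x.
rewrite (_ : [set _ | _] = xsection (@cons_pair _ T m @^-1` B) x).
  apply: measurable_xsection; rewrite -[X in measurable X]setTI.
  exact: measurable_cons_pair.
by apply/seteqP; split => e /=; rewrite /xsection/= inE.
Qed.

Lemma measurable_iid_law_section m (B : set (m.+1.-tuple T)) : measurable B ->
  measurable_fun setT (fun x => iid_law mu m [set e | B (cons_pair (x, e))]).
Proof.
move=> mB.
have mB' : measurable (@cons_pair _ T m @^-1` B).
  by rewrite -[X in measurable X]setTI; exact: measurable_cons_pair.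
rewrite (_ : (fun x => _) = iid_law mu m \o xsection (@cons_pair _ T m @^-1` B)).
  exact: measurable_fun_xsection.
apply/funext => x /=; congr (iid_law mu m _).
by apply/seteqP; split => e /=; rewrite /xsection/= inE.
Qed.

End iid_facts.

(** * A maximal inequality for weighted partial sums *)

Section maximal.
Context {R : realType}.
Variables (mu : probability R R) (sigma : R).
Hypothesis mu_mean : ('E_mu[idfun] = 0)%E.
Hypothesis mu_var : ('V_mu[idfun] = (sigma ^+ 2)%:E)%E.

Lemma integral_sqr : (\int[mu]_x (x ^+ 2)%:E = (sigma ^+ 2)%:E)%E.
Proof.
rewrite -mu_var /variance covariance.unlock mu_mean/= expectation.unlock.
by apply: eq_integral => x _ /=; rewrite expr2 !fctE/= subr0.
Qed.

Lemma integrable_sqr : mu.-integrable setT (fun x : R => (x ^+ 2)%:E).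
Proof.
apply/integrableP; split; first exact/measurable_EFinP/measurable_funX.
under eq_integral do rewrite gee0_abs ?lee_fin ?sqr_ge0//.
by rewrite integral_sqr ltry.
Qed.

Lemma integrable_id : mu.-integrable setT (fun x : R => x%:E).
Proof.
have int1 : mu.-integrable setT (fun x : R => (1 + x ^+ 2)%:E).
  rewrite (_ : (fun _ => _) = cst 1%:E \+ (fun x : R => (x ^+ 2)%:E))%E//.
  apply: integrableD => //; last exact: integrable_sqr.
  exact: finite_measure_integrable_cst.
apply: le_integrable int1 => //; first exact/measurable_EFinP.
move=> x _; rewrite lee_fin [leRHS]ger0_norm ?addr_ge0 ?sqr_ge0//.
by rewrite ler_norml; apply/andP; split; nra.
Qed.

Lemma integral_quadratic (a s c : R) :
  (\int[mu]_x (a * (s + x) ^+ 2 + c)%:E = (a * (s ^+ 2 + sigma ^+ 2) + c)%:E)%E.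
Proof.
have i1 := integrable_id; have i2 := integrable_sqr.
have ic (k : R) : mu.-integrable setT (cst k%:E).
  exact: finite_measure_integrable_cst.
have -> : (fun x : R => (a * (s + x) ^+ 2 + c)%:E) =
   (fun x => (a%:E * (x ^+ 2)%:E + ((2 * a * s)%:E * x%:E + cst (a * s ^+ 2 + c)%:E x)))%E.
  by apply/funext => x; rewrite -!EFinM -!EFinD; congr (_%:E); ring.
have iZ (k : R) (f : R -> R) : mu.-integrable setT (EFin \o f) ->
    mu.-integrable setT (fun x => (k%:E * (f x)%:E)%E).
  by move=> jf; exact: (integrableZl measurableT k jf).
rewrite (integralD measurableT (iZ _ _ i2)); last first.
  exact: (integrableD measurableT (iZ _ _ i1) (ic _)).
rewrite (integralD measurableT (iZ _ _ i1) (ic _)).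
have icst (k : R) : (\int[mu]_x cst k%:E x = k%:E)%E.
  apply: (eq_trans (integral_cst mu measurableT k%:E)).
  by rewrite -[RHS]mule1; congr (_ * _)%E; exact: probability_setT.
rewrite icst !integralZl// integral_sqr.
have -> : (\int[mu]_x x%:E = 0)%E by rewrite -mu_mean expectation.unlock.
by rewrite mule0 add0e -EFinM -EFinD; congr (_%:E); ring.
Qed.

Definition crosses m (w : nat -> R) (s : R) : set (m.-tuple R) :=
  [set e | exists k : 'I_m,
     1 <= w k * (s + \sum_(i < m | (i <= k)%N) tnth e i) ^+ 2].
Arguments crosses m : clear implicits.

Lemma measurable_crosses m w s : measurable (crosses m w s).
Proof.
pose F (k : 'I_m) (e : m.-tuple R) :=
  w k * (s + \sum_(i < m) if (i <= k)%N then tnth e i else 0) ^+ 2.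
have mF k : measurable_fun setT (F k).
  apply: measurable_funM => //; apply: measurable_funX.
  apply: measurable_funD => //; apply: measurable_sum => i.
  by case: (i <= k)%N => //; exact: measurable_tnth.
rewrite (_ : crosses m w s = \bigcup_(k in [set: 'I_m]) F k @^-1` `[1, +oo[).
  apply: fin_bigcup_measurable => // k _.
  by rewrite -[X in measurable X]setTI; exact: mF.
apply/seteqP; split => e /=.
  by move=> [k hk]; exists k => //=; rewrite in_itv/= andbT /F -big_mkcond.
by move=> [k _ /=]; rewrite in_itv/= andbT /F -big_mkcond => hk; exists k.
Qed.

Lemma crosses_cons m w s x (e : m.-tuple R) :
  crosses m.+1 w s (cons_pair (x, e)) <->
  1 <= w 0%N * (s + x) ^+ 2 \/ crosses m (w \o S) (s + x) e.
Proof.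
have E (k : 'I_m.+1) : s + \sum_(i < m.+1 | (i <= k)%N) tnth (cons_pair (x, e)) i
    = (s + x) + \sum_(i < m | (i < k)%N) tnth e i.
  rewrite big_mkcond big_ord_recl/= tnth0 addrA; congr (_ + _).
  rewrite [RHS]big_mkcond; apply: eq_bigr => i _.
  by rewrite /cons_pair tnthS.
split.
- move=> [k]; rewrite E; case: (unliftP ord0 k) => [j|] ->.
    by rewrite lift0 => h; right; exists j.
  by rewrite big_pred0// addr0 => h; left.
- move=> [h|[j h]].
    by exists ord0; rewrite E big_pred0// addr0.
  by exists (lift ord0 j); rewrite E lift0.
Qed.

(** Hajek-Renyi inequality, for sums started at an arbitrary s.  The starting
    point makes a direct induction possible: conditionally on the first
    observation x, either the sum crosses at once and w 0 * (s + x)^2 >= 1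
    bounds the probability, or the remaining sums, started at s + x, satisfy
    the induction hypothesis, whose bound is no larger than
    w 0 * (s + x)^2 + sigma^2 * (sum of the later weights) as w decreases.
    Averaging over the centred x turns w 0 * (s + x)^2 into w 0 * (s^2 + sigma^2). *)
Lemma maximal_inequality m (w : nat -> R) (s : R) :
  (forall k, 0 <= w k) -> (forall k, w k.+1 <= w k) ->
  (iid_law mu m (crosses m w s) <=
    (w 0%N * s ^+ 2 + sigma ^+ 2 * \sum_(k < m) w k)%:E)%E.
Proof.
elim: m w s => [|m IH] w s w0 wn.
  rewrite (_ : crosses 0 w s = set0); last by apply/seteqP; split => // e [[]].
  by rewrite measure0 lee_fin big_ord0 mulr0 addr0 mulr_ge0 ?sqr_ge0.
rewrite iid_lawS.
set c := sigma ^+ 2 * \sum_(k < m) w k.+1.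
have c0 : 0 <= c by rewrite mulr_ge0 ?sqr_ge0// sumr_ge0.
rewrite (_ : w 0%N * s ^+ 2 + _ = w 0%N * (s ^+ 2 + sigma ^+ 2) + c); last first.
  rewrite big_ord_recl/= /c.
  rewrite mulrDr mulrDr addrA (mulrC (w 0%N) (sigma ^+ 2)).
  by congr (_ + _ * _); apply: eq_bigr.
rewrite -integral_quadratic.
apply: ge0_le_integral => //.
- exact: measurable_iid_law_section (@measurable_crosses _ _ _).
- apply/measurable_EFinP; apply: measurable_funD => //.
  by apply: measurable_funM => //; apply: measurable_funX; exact: measurable_funD.
- move=> x _; have [h|h] := leP 1 (w 0%N * (s + x) ^+ 2).
    apply: (le_trans (probability_le1 _ _)).
      exact: measurable_section (@measurable_crosses _ _ _) _.
    by rewrite lee_fin -[leLHS]addr0 lerD.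
  rewrite (_ : [set _ | _] = crosses m (w \o S) (s + x)); last first.
    apply/seteqP; split => e /=.
      by move=> /crosses_cons[|//]; rewrite leNgt h.
    by move=> he; apply/crosses_cons; right.
  apply: (le_trans (IH (w \o S) (s + x) _ _)) => /=.
  + by move=> k; exact: w0.
  + by move=> k; exact: wn.
  + by rewrite lee_fin /c lerD2r ler_wpM2r ?sqr_ge0.
Qed.

End maximal.

(** * Hellinger affinity of shifted product laws *)

Section affinity.
Context {R : realType}.
Variables (mu : probability R R) (phi : R -> R) (M : R).
Hypothesis mu_density : has_density mu phi.
Hypothesis M_gt0 : 0 < M.
Hypothesis phi_hellinger : forall a : R,
  (\int[lebesgue_measure]_y
      ((Num.sqrt (phi (y - a)) - Num.sqrt (phi y)) ^+ 2)%:E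
    <= (M * a ^+ 2)%:E)%E.
Notation leb := (@lebesgue_measure R).

Let mphi : measurable_fun [set: R] phi. Proof. by case: mu_density. Qed.
Let phi_ge0 y : (0 <= phi y)%R. Proof. by case: mu_density. Qed.

Let mphi_shift d : measurable_fun [set: R] (fun y => phi (y - d)).
Proof.
apply: measurableT_comp => //; exact: measurable_translate.
Qed.

Let msqrt (f : R -> R) : measurable_fun [set: R] f ->
  measurable_fun [set: R] (fun y => Num.sqrt (f y)).
Proof.
move=> mf.
exact: (measurableT_comp (continuous_measurable_fun (@sqrt_continuous R)) mf).
Qed.

Definition root_overlap d y := Num.sqrt (phi y) * Num.sqrt (phi (y - d)).

Lemma root_overlap_ge0 d y : 0 <= root_overlap d y.
Proof. by rewrite mulr_ge0// sqrtr_ge0. Qed.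

Lemma measurable_root_overlap d : measurable_fun [set: R] (root_overlap d).
Proof. by apply: measurable_funM; exact: msqrt. Qed.

Lemma integral_density : (\int[leb]_y (phi y)%:E = 1)%E.
Proof.
case: mu_density => _ _ /(_ setT measurableT) <-; exact: probability_setT.
Qed.

Lemma integral_density_shift d : (\int[leb]_y (phi (y - d))%:E = 1)%E.
Proof.
have := @ge0_integral_translate R (- d) (EFin \o phi).
rewrite /= integral_density; apply; first exact/measurable_EFinP.
by move=> x; rewrite lee_fin.
Qed.

(** As both densities have mass 1, the Hellinger integral is 2 - 2 * affinity. *)
Lemma affinity_ge d :
  ((1 - M / 2 * d ^+ 2)%:E <= \int[leb]_y (root_overlap d y)%:E)%E.
Proof.
set rho := (\int[leb]_y _)%E.
pose h y := (Num.sqrt (phi (y - d)) - Num.sqrt (phi y)) ^+ 2.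
have mh : measurable_fun [set: R] (EFin \o h).
  apply/measurable_EFinP/measurable_funX/measurable_funB; exact: msqrt.
have mr : measurable_fun [set: R] (EFin \o root_overlap d).
  by apply/measurable_EFinP; exact: measurable_root_overlap.
have e2 : (2%:E = \int[leb]_y (h y)%:E + 2%:E * rho)%E.
  rewrite -ge0_integralZl//; last first.
    by move=> x _; rewrite lee_fin root_overlap_ge0.
  rewrite -ge0_integralD//; first last.
  - exact: (measurable_funeM _ mr).
  - by move=> x _; rewrite -EFinM lee_fin mulr_ge0// root_overlap_ge0.
  - by move=> x _; rewrite lee_fin sqr_ge0.
  transitivity (\int[leb]_y ((phi y)%:E + (phi (y - d))%:E))%E.
    rewrite ge0_integralD//; first by rewrite integral_density integral_density_shift.
    - by move=> x _; rewrite lee_fin.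
    - by apply/measurable_EFinP.
    - by move=> x _; rewrite lee_fin.
    - by apply/measurable_EFinP; exact: mphi_shift.
  apply: eq_integral => y _; rewrite -EFinM -!EFinD; congr (_%:E).
  rewrite /h /root_overlap -{1}(sqr_sqrtr (phi_ge0 y)).
  by rewrite -{1}(sqr_sqrtr (phi_ge0 (y - d))); ring.
have rho0 : (0 <= rho)%E by apply: integral_ge0 => y _; rewrite lee_fin root_overlap_ge0.
have h0 : (0 <= \int[leb]_y (h y)%:E)%E.
  by apply: integral_ge0 => y _; rewrite lee_fin sqr_ge0.
have hI : (\int[leb]_y (h y)%:E <= (M * d ^+ 2)%:E)%E := phi_hellinger d.
move: e2 h0 rho0 hI; set I := (\int[leb]_y (h y)%:E)%E; clearbody I rho.
case: I => [I||]//; case: rho => [r||]//=.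
  by rewrite -EFinM -EFinD => -[e2] _ _; rewrite !lee_fin => hI; lra.
by rewrite gt0_muley ?lte_fin//.
Qed.

Definition perturb m (D : nat -> R) (e : m.-tuple R) : m.-tuple R :=
  [tuple tnth e i + D i | i < m].

Lemma measurable_perturb m (D : nat -> R) :
  measurable_fun [set: m.-tuple R] (@perturb m D).
Proof.
apply/measurable_fun_tnthP => j.
rewrite (_ : _ \o _ = fun e : m.-tuple R => tnth e j + D j).
  by apply: measurable_funD => //; exact: measurable_tnth.
by apply/funext => e /=; rewrite tnth_mktuple.
Qed.

Lemma perturb_cons m D (x : R) (e : m.-tuple R) :
  perturb D (cons_pair (x, e)) = cons_pair (translate (D 0%N) x, perturb (D \o S) e).
Proof.
apply: eq_from_tnth => i; rewrite tnth_mktuple /cons_pair.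
case: (unliftP ord0 i) => [j|] ->; first by rewrite !tnthS tnth_mktuple.
by rewrite !tnth0.
Qed.

Lemma measurable_preimage_perturb m D (B : set (m.-tuple R)) :
  measurable B -> measurable (perturb D @^-1` B).
Proof.
by move=> mB; rewrite -[X in measurable X]setTI; exact: measurable_perturb.
Qed.

(** Pointwise form of the induction step of [product_affinity_ge].  The weights
    s and t being arbitrary, the hypothesis can be used with s u / v and
    t u / v, where u, v are the roots of p, q; multiplying by u v then
    redistributes p and q over the terms. *)
Lemma weighted_roots_le (L s t a b a' b' p q : R) : 0 <= L -> 0 < s -> 0 < t ->
  0 <= a -> 0 <= b -> 0 <= a' -> 0 <= b' -> 0 <= p -> 0 <= q ->
  (forall s t, 0 < s -> 0 < t -> 2 * L <= s * a + s^-1 * b + t * a' + t^-1 * b') ->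
  2 * L * (Num.sqrt p * Num.sqrt q) <=
  s * (a * p) + s^-1 * (b * q) + t * (a' * p) + t^-1 * (b' * q).
Proof.
move=> L0 s0 t0 a0 b0 a'0 b'0 p0 q0 h.
have pos k k' (x y z w : R) : 0 <= x -> 0 <= y -> 0 <= z -> 0 <= w -> 0 < k -> 0 < k' ->
   0 <= k * (x * p) + k^-1 * (y * q) + k' * (z * p) + k'^-1 * (w * q).
  move=> x0 y0 z0 w0 k0 k'0.
  by rewrite !addr_ge0// mulr_ge0 ?invr_ge0 ?(ltW k0) ?(ltW k'0)// mulr_ge0.
have [p_eq0|p_neq0] := eqVneq p 0.
  by rewrite {1}p_eq0 sqrtr0 mul0r [leLHS]mulr0; exact: pos.
have [q_eq0|q_neq0] := eqVneq q 0.
  by rewrite {1}q_eq0 sqrtr0 mulr0 [leLHS]mulr0; exact: pos.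
have u0 : 0 < Num.sqrt p by rewrite sqrtr_gt0 lt_def p_neq0.
have v0 : 0 < Num.sqrt q by rewrite sqrtr_gt0 lt_def q_neq0.
rewrite -{2 3}(sqr_sqrtr p0) -{2 3}(sqr_sqrtr q0).
move: (Num.sqrt p) (Num.sqrt q) u0 v0 => u v u0 v0.
have uv0 := divr_gt0 u0 v0.
have := h (s * (u / v)) (t * (u / v)) (mulr_gt0 s0 uv0) (mulr_gt0 t0 uv0).
rewrite -(ler_pM2r (mulr_gt0 u0 v0)) => /le_trans; apply.
rewrite le_eqVlt; apply/orP; left; apply/eqP; field.
by rewrite !gt_eqF.
Qed.

Lemma fin_iid_law m (B : set (m.-tuple R)) : measurable B ->
  exists2 r : R, 0 <= r & iid_law mu m B = r%:E.
Proof.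
move=> mB; exists (fine (iid_law mu m B)); first by rewrite fine_ge0.
by rewrite fineK// fin_num_measure.
Qed.

(** This is not an instance of [measurable_iid_law_section], because the first
    observation is not shifted here; it becomes one for the shift vector whose
    first component is 0. *)
Lemma measurable_perturb_section m D (B : set (m.+1.-tuple R)) : measurable B ->
  measurable_fun [set: R] (fun x =>
    iid_law mu m (perturb (D \o S) @^-1` [set e | B (cons_pair (x, e))])).
Proof.
move=> mB.
pose B' := perturb (fun k => if k is k'.+1 then D k else 0) @^-1` B.
have mB' : measurable B' by exact: measurable_preimage_perturb.
rewrite (_ : (fun x => _) = fun x => iid_law mu m [set e | B' (cons_pair (x, e))]).
  exact: measurable_iid_law_section.
apply/funext => x; congr (iid_law mu m _); apply/seteqP; split => e /=;
  by rewrite /B'/= perturb_cons /translate addr0.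
Qed.

Lemma iid_law_perturb_cons m D (B : set (m.+1.-tuple R)) : measurable B ->
  iid_law mu m.+1 (perturb D @^-1` B) =
  (\int[leb]_x (iid_law mu m
     (perturb (D \o S) @^-1` [set e | B (cons_pair (x, e))]) *
       (phi (x - D 0%N))%:E))%E.
Proof.
move=> mB.
pose h x := iid_law mu m (perturb (D \o S) @^-1` [set e | B (cons_pair (x, e))]).
have mh : measurable_fun [set: R] h by exact: measurable_perturb_section.
rewrite iid_lawS.
transitivity (\int[mu]_x h (translate (D 0%N) x))%E.
  apply: eq_integral => x _; congr (iid_law mu m _).
  by apply/seteqP; split => e /=; rewrite perturb_cons.
have mt := @measurable_translate R (D 0%N).
rewrite (ge0_integral_density mu_density); last 2 first.
- exact: (measurableT_comp mh mt).
- by move=> x; exact: measure_ge0.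
rewrite -(@ge0_integral_translate R (D 0%N)
  (fun x => h x * (phi (x - D 0%N))%:E)%E).
- by apply: eq_integral => x _; rewrite /translate addrK.
- by apply: emeasurable_funM => //; apply/measurable_EFinP; exact: mphi_shift.
- by move=> x; rewrite mule_ge0// lee_fin.
Qed.

(** With P, Q the laws of the sample and of the shifted sample, minimising the
    right-hand side over s and t gives
      1 - (M / 2) * sum D i ^ 2 <= sqrt (P B * Q B) + sqrt (P ~B * Q ~B),
    the bound that the multiplicativity of affinities and the Cauchy-Schwarz
    inequality provide.  With s and t free the bound has no square roots and is
    linear in the four probabilities, so it can be integrated over the first
    observation, which makes the induction work. *)
Lemma product_affinity_ge m (D : nat -> R) (B : set (m.-tuple R)) (s t : R) :
  measurable B -> 0 < s -> 0 < t ->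
  ((2 * (1 - M / 2 * \sum_(i < m) D i ^+ 2))%:E <=
    s%:E * iid_law mu m B + s^-1%:E * iid_law mu m (perturb D @^-1` B) +
    t%:E * iid_law mu m (~` B) + t^-1%:E * iid_law mu m (perturb D @^-1` (~` B)))%E.
Proof.
elim: m D B s t => [|m IH] D B s t mB s0 t0.
  rewrite big_ord0 mulr0 subr0 mulr1.
  have amgm (x : R) : 0 < x -> 2 <= x + x^-1.
    move=> x0; rewrite -subr_ge0 (_ : _ - _ = (x - 1) ^+ 2 * x^-1).
      by rewrite mulr_ge0 ?sqr_ge0// invr_ge0 ltW.
    by field; rewrite gt_eqF.
  have d0 (C : set (0.-tuple R)) : perturb D @^-1` C = C.
    by apply/seteqP; split => e /=; rewrite (tuple0 e) (tuple0 (perturb _ _)).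
  rewrite !d0 /= !diracE.
  have [BT|BF] := pselect (B [tuple]).
  - rewrite mem_set// memNset; last by move=> /(_ BT).
    by rewrite !mule1 !mule0 !adde0 -EFinD lee_fin amgm.
  - rewrite memNset// mem_set//.
    by rewrite !mule1 !mule0 !add0e -EFinD lee_fin amgm.
(* The induction hypothesis has constant L; a negative L makes the claim trivial,
   a nonnegative one can be multiplied by the lower bound of the affinity. *)
set L := 1 - M / 2 * \sum_(i < m) D i.+1 ^+ 2.
have mC : measurable (~` B) by exact: measurableC.
have sum_ge0 k (F : nat -> R) : 0 <= \sum_(i < k) F i ^+ 2.
  by apply: sumr_ge0 => i _; exact: sqr_ge0.
have [L_lt0|L_ge0] := ltP L 0.
  apply: (@le_trans _ _ 0%E).
    rewrite lee_fin big_ord_recl/=; move: L_lt0; rewrite /L.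
    under [in X in _ -> X]eq_bigr do rewrite /bump/= add1n.
    by have := mulr_ge0 (ltW M_gt0) (sqr_ge0 (D 0%N)); lra.
  by rewrite !adde_ge0// mule_ge0 ?lee_fin ?invr_ge0// ltW.
pose PB (C : set (m.+1.-tuple R)) x := iid_law mu m [set e | C (cons_pair (x, e))].
pose QB (C : set (m.+1.-tuple R)) x :=
  iid_law mu m (perturb (D \o S) @^-1` [set e | C (cons_pair (x, e))]).
have PE C : measurable C ->
    iid_law mu m.+1 C = (\int[leb]_x (PB C x * (phi x)%:E))%E.
  move=> mCC; rewrite iid_lawS (ge0_integral_density mu_density)//.
  exact: measurable_iid_law_section.
have QE C : measurable C -> iid_law mu m.+1 (perturb D @^-1` C) =
    (\int[leb]_x (QB C x * (phi (x - D 0%N))%:E))%E.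
  exact: iid_law_perturb_cons.
have mPB C : measurable C -> measurable_fun [set: R] (fun x => PB C x * (phi x)%:E)%E.
  move=> mCC; apply: emeasurable_funM; last exact/measurable_EFinP.
  exact: measurable_iid_law_section.
have mQB C : measurable C ->
    measurable_fun [set: R] (fun x => QB C x * (phi (x - D 0%N))%:E)%E.
  move=> mCC; apply: emeasurable_funM; first exact: measurable_perturb_section.
  by apply/measurable_EFinP; exact: mphi_shift.
have PB0 C x : (0 <= PB C x * (phi x)%:E)%E by rewrite mule_ge0// lee_fin.
have QB0 C x : (0 <= QB C x * (phi (x - D 0%N))%:E)%E by rewrite mule_ge0// lee_fin.
have mroot : measurable_fun [set: R] (fun x => (root_overlap (D 0%N) x)%:E).
  by apply/measurable_EFinP; exact: measurable_root_overlap.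
apply: (@le_trans _ _ (\int[leb]_x ((2 * L)%:E * (root_overlap (D 0%N) x)%:E))%E).
  rewrite ge0_integralZl//; last 2 first.
  - by move=> x _; rewrite lee_fin root_overlap_ge0.
  - by rewrite lee_fin mulr_ge0.
  apply: (@le_trans _ _ ((2 * L)%:E * (1 - M / 2 * D 0%N ^+ 2)%:E)%E); last first.
    by apply: lee_wpmul2l; [rewrite lee_fin mulr_ge0|exact: affinity_ge].
  rewrite -EFinM lee_fin big_ord_recl/=.
  under eq_bigr do rewrite /bump/= add1n.
  have := mulr_ge0 (ltW M_gt0) (sqr_ge0 (D 0%N)).
  have := mulr_ge0 (ltW M_gt0) (sum_ge0 m (D \o S)).
  rewrite /L /=; set x := D 0%N ^+ 2; set y := \sum_(i < m) _ => y0 x0.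
  have := mulr_ge0 y0 x0; nra.
have si0 : (0 <= s^-1%:E)%E by rewrite lee_fin invr_ge0 ltW.
have ti0 : (0 <= t^-1%:E)%E by rewrite lee_fin invr_ge0 ltW.
have sE0 : (0 <= s%:E)%E by rewrite lee_fin ltW.
have tE0 : (0 <= t%:E)%E by rewrite lee_fin ltW.
rewrite (PE _ mB) (PE _ mC) (QE _ mB) (QE _ mC).
rewrite -!ge0_integralZl//; [|exact: mQB|exact: mPB|exact: mQB|exact: mPB].
pose F1 x := (s%:E * (PB B x * (phi x)%:E))%E.
pose F2 x := (s^-1%:E * (QB B x * (phi (x - D 0%N))%:E))%E.
pose F3 x := (t%:E * (PB (~` B) x * (phi x)%:E))%E.
pose F4 x := (t^-1%:E * (QB (~` B) x * (phi (x - D 0%N))%:E))%E.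
have F10 x : (0 <= F1 x)%E by exact: mule_ge0.
have F20 x : (0 <= F2 x)%E by exact: mule_ge0.
have F30 x : (0 <= F3 x)%E by exact: mule_ge0.
have F40 x : (0 <= F4 x)%E by exact: mule_ge0.
have mF1 : measurable_fun [set: R] F1 by apply: measurable_funeM; exact: mPB.
have mF2 : measurable_fun [set: R] F2 by apply: measurable_funeM; exact: mQB.
have mF3 : measurable_fun [set: R] F3 by apply: measurable_funeM; exact: mPB.
have mF4 : measurable_fun [set: R] F4 by apply: measurable_funeM; exact: mQB.
have mF12 : measurable_fun [set: R] (F1 \+ F2)%E by exact: emeasurable_funD.
have mF123 : measurable_fun [set: R] (F1 \+ F2 \+ F3)%E by exact: emeasurable_funD.
have -> : (\int[leb]_x F1 x + \int[leb]_x F2 x + \int[leb]_x F3 x + \int[leb]_x F4 x =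
    \int[leb]_x (F1 x + F2 x + F3 x + F4 x))%E.
  rewrite ge0_integralD//; last by move=> x _; rewrite !adde_ge0.
  rewrite ge0_integralD//; last by move=> x _; rewrite adde_ge0.
  by rewrite ge0_integralD.
apply: ge0_le_integral => //.
- by move=> x _; rewrite -EFinM lee_fin mulr_ge0 ?root_overlap_ge0// mulr_ge0.
- exact: measurable_funeM.
- exact: emeasurable_funD.
- move=> x _.
  have mBx := measurable_section mB x; have mCx := measurable_section mC x.
  have IHx s' t' (s'0 : 0 < s') (t'0 : 0 < t') := IH (D \o S) _ s' t' mBx s'0 t'0.
  have [a a0 aE] := fin_iid_law mBx.
  have [a' a'0 a'E] := fin_iid_law mCx.
  have [b b0 bE] := fin_iid_law (measurable_preimage_perturb (D \o S) mBx).
  have [b' b'0 b'E] := fin_iid_law (measurable_preimage_perturb (D \o S) mCx).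
  rewrite /F1 /F2 /F3 /F4 /PB /QB aE bE a'E b'E -!EFinM -!EFinD lee_fin.
  apply: weighted_roots_le => // s' t' s'0 t'0.
  have := IHx s' t' s'0 t'0.
  rewrite aE bE [X in (t'%:E * X)%E]a'E [X in (t'^-1%:E * X)%E]b'E.
  by rewrite -!EFinM -!EFinD lee_fin.
Qed.

End affinity.

(** * The estimator as a saddle value of block means *)

Section step_integral.
Context {R : realType}.
Notation leb := (@lebesgue_measure R).

Definition clip (a b s : R) := Num.max a (Num.min b s).

(** [clip a b] is a primitive of the indicator of the interval from a to b. *)
Lemma integral_indic_itv (a b u v : R) : a <= b -> u <= v ->
  (\int[leb]_(t in `[u, v]) (\1_`]a, b] t)%:E = (clip a b v - clip a b u)%:E)%E.
Proof.
move=> ab uv; rewrite integral_indic//.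
have hlt (x y : R) : lebesgue_measure `]x, y] = (Num.max x y - x)%:E :> \bar R.
  rewrite lebesgue_measure_itv/= lte_fin; case: ltP => h; rewrite ?subrr//.
have hle (x y : R) : lebesgue_measure `[x, y] = (Num.max x y - x)%:E :> \bar R.
  rewrite lebesgue_measure_itv/= lte_fin; case: ltP => h; rewrite ?subrr//.
have [ua|au] := leP u a.
- rewrite (_ : _ `&` _ = `]a, Num.min b v]%classic).
    apply: (eq_trans (hlt _ _)); congr (_%:E); rewrite /clip.
    by rewrite (min_idPr (le_trans ua ab)) (max_idPl ua).
  apply/seteqP; split => x /=; rewrite !in_itv/= le_min.
    by move=> [/andP[-> ->] /andP[_ ->]].
  by move=> /and3P[ax -> ->]; rewrite ax; split=> //; rewrite andbT (le_trans ua) ?ltW.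
- rewrite (_ : _ `&` _ = `[u, Num.min b v]%classic).
    apply: (eq_trans (hle _ _)); congr (_%:E); rewrite /clip.
    have [bu|ub] := leP b u.
      by rewrite (min_idPl (le_trans bu uv)) (max_idPr ab) (max_idPl bu) !subrr.
    rewrite (max_idPr (ltW au)); congr (_ - _).
    have h : u <= Num.min b v by rewrite le_min uv ltW.
    by rewrite (max_idPr h) (max_idPr (le_trans (ltW au) h)).
  apply/seteqP; split => x /=; rewrite !in_itv/= le_min.
    by move=> [/andP[_ ->] /andP[-> ->]].
  by move=> /and3P[ux -> ->]; rewrite ux; split=> //; rewrite andbT (lt_le_trans au).
Qed.

Lemma Rintegral_step (I : finType) (c a b : I -> R) (u v : R) :
  (forall i, a i <= b i) -> u <= v ->
  \int[leb]_(t in `[u, v]) (\sum_i c i * \1_`]a i, b i] t)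
  = \sum_i c i * (clip (a i) (b i) v - clip (a i) (b i) u).
Proof.
move=> ab uv; rewrite /Rintegral.
have fin : (leb `[u, v] < +oo)%E.
  by rewrite lebesgue_measure_itv/=; case: ifP => _; rewrite -?EFinB ltry.
have int1 i : leb.-integrable `[u, v] (fun t => (\1_`]a i, b i] t)%:E).
  apply/integrableP; split.
    by apply/measurable_EFinP; exact: measurable_indic.
  under eq_integral do rewrite gee0_abs ?lee_fin//.
  by rewrite integral_indic_itv// ltry.
under eq_integral do rewrite -sumEFin.
rewrite integral_sum//; last first.
  by move=> i; exact: (integrableZl _ (c i) (int1 i)).
transitivity (fine (\sum_i (c i * (clip (a i) (b i) v - clip (a i) (b i) u))%:E)%E).
  congr fine; apply: eq_bigr => i _; under eq_integral do rewrite EFinM.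
  by rewrite integralZl// integral_indic_itv.
by rewrite sumEFin.
Qed.

End step_integral.

(** Among the chords that join a point on the left of c to a point on the right of
    c, take one whose height above c is least.  A point of the graph below this
    chord could replace the end of the chord on its own side of c, which would
    lower the height. *)
Lemma supporting_chord (R : realFieldType) (m : nat) (X G : nat -> R) (c : R) :
  (forall j, (j < m)%N -> X j < c) ->
  (forall l, (l < m)%N -> c < X (m + l)%N) -> (0 < m)%N ->
  exists j l : 'I_m, exists v : R,
    [/\ G (m + l)%N = G j + v * (X (m + l)%N - X j),
        forall l' : 'I_m, G j + v * (X (m + l')%N - X j) <= G (m + l')%N &
        forall j' : 'I_m, G j + v * (X j' - X j) <= G j'].
Proof.
move=> Xc cX m_gt0.
pose slope (j l : nat) := (G (m + l)%N - G j) / (X (m + l)%N - X j).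
pose height (p : 'I_m * 'I_m) := G p.1 + slope p.1 p.2 * (c - X p.1).
pose o := Ordinal m_gt0.
have [[j l] _ /= minp] := @arg_minP _ _ _ (o, o) predT height isT.
have gap (j' l' : 'I_m) : 0 < X (m + l')%N - X j'.
  by rewrite subr_gt0 (lt_trans (Xc _ (ltn_ord j')) (cX _ (ltn_ord l'))).
have slopeE (j' l' : 'I_m) : slope j' l' * (X (m + l')%N - X j') = G (m + l')%N - G j'.
  by rewrite /slope divfK// gt_eqF.
exists j, l, (slope j l); split.
- by rewrite slopeE; ring.
- move=> l'; have := minp (j, l') isT; rewrite /height/= lerD2l ler_pM2r; last first.
    by rewrite subr_gt0 Xc.
  rewrite -(ler_pM2r (gap j l')) slopeE => h.
  by rewrite -lerBrDl.
- move=> j'; have := minp (j', l) isT.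
  have heightE (i : 'I_m) : height (i, l) =
      G (m + l)%N - slope i l * (X (m + l)%N - c).
    have := slopeE i l; rewrite /height/= => h.
    rewrite -[G (m + l)%N](subrK (G i)) -h; ring.
  rewrite !heightE lerD2l lerN2 ler_pM2r; last by rewrite subr_gt0 cX.
  rewrite -(ler_pM2r (gap j' l)) slopeE => h.
  by have := slopeE j l; lra.
Qed.

Section envelope.
Context {R : realType} (n : nat) (y : n.*2.+1.-tuple R).
Hypothesis n_gt0 : (0 < n)%N.

Let nR : 0 < n%:R :> R. Proof. by rewrite ltr0n. Qed.

(** The 2n+2 end points of the cells of [ghat], numbered from 0: [knot n k] is
    (k - n - 1) / n, so the observation with entry number j lives on the cell
    from [knot n j] to [knot n j.+1], and 0 is [knot n n.+1]. *)
Definition knot (k : nat) : R := (k%:R - n.+1%:R) / n%:R.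

Lemma design_left (j : 'I_n.*2.+1) : design n (sample_index j - 1) = knot j.
Proof.
rewrite /design /knot /sample_index; congr (_ / _).
by rewrite !rmorphB/= -!pmulrn -[n.+1]addn1 natrD opprD addrA.
Qed.

Lemma design_right (j : 'I_n.*2.+1) : design n (sample_index j) = knot j.+1.
Proof.
rewrite /design /knot /sample_index; congr (_ / _).
rewrite !rmorphB/= -!pmulrn -[n.+1]addn1 -[j.+1]addn1 !natrD.
by rewrite opprD addrACA subrr addr0.
Qed.

Lemma ler_knot i k : (knot i <= knot k) = (i <= k)%N.
Proof. by rewrite /knot ler_pM2r ?invr_gt0// lerD2r ler_nat. Qed.

Lemma ltr_knot i k : (knot i < knot k) = (i < k)%N.
Proof. by rewrite ltNge ler_knot ltnNge. Qed.

Lemma knot_origin : knot n.+1 = 0.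
Proof. by rewrite /knot subrr mul0r. Qed.

Lemma knot0 : knot 0 = -1 - n%:R^-1.
Proof.
by rewrite /knot sub0r -[n.+1]addn1 natrD; field; rewrite gt_eqF.
Qed.

Lemma knot_last : knot n.*2.+1 = 1.
Proof.
rewrite /knot -[n.+1]addn1 -[n.*2.+1]addn1 -addnn !natrD; field.
by rewrite gt_eqF.
Qed.

Lemma knotB i k : (i <= k)%N -> knot k - knot i = (k - i)%:R / n%:R.
Proof. by move=> ik; rewrite /knot natrB//; field; rewrite gt_eqF. Qed.

Lemma GhatE s : Ghat y s =
  \sum_(j < n.*2.+1) tnth y j * (clip (knot j) (knot j.+1) s - clip (knot j) (knot j.+1) 0).
Proof.
have e : ghat y = fun t => \sum_(j < n.*2.+1) tnth y j * \1_`]knot j, knot j.+1] t.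
  apply/funext => t; rewrite /ghat; apply: eq_bigr => j _.
  by rewrite design_left design_right.
rewrite /Ghat e; case: leP => s0.
  by rewrite Rintegral_step// => i; rewrite ler_knot.
rewrite Rintegral_step ?(ltW s0)//; last by move=> i; rewrite ler_knot.
by rewrite -sumrN; apply: eq_bigr => i _; rewrite -mulrN opprB.
Qed.

Definition cum (k : nat) : R := (\sum_(j < n.*2.+1 | (j < k)%N) tnth y j) / n%:R.

Lemma clip_knot j k : clip (knot j) (knot j.+1) (knot k) =
  if (j < k)%N then knot j.+1 else knot j.
Proof.
rewrite /clip; case: ltnP => jk.
  by rewrite (min_idPl _) ?ler_knot// (max_idPr _)// ler_knot.
by rewrite (min_idPr _) ?ler_knot ?(leq_trans jk)// (max_idPl _)// ler_knot.
Qed.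

Lemma Ghat_knot k : Ghat y (knot k) = cum k - cum n.+1.
Proof.
transitivity (\sum_(j < n.*2.+1) tnth y j *
    (clip (knot j) (knot j.+1) (knot k) - clip (knot j) (knot j.+1) (knot n.+1))).
  by rewrite knot_origin GhatE.
rewrite /cum -mulrBl.
rewrite [X in (X - _) / _]big_mkcond [X in (_ - X) / _]big_mkcond/= -sumrB mulr_suml.
apply: eq_bigr => j _; rewrite !clip_knot.
have e : knot j.+1 - knot j = n%:R^-1 by rewrite knotB// subSnn mul1r.
do 2 case: ifP => _; rewrite ?subrr ?mulr0 ?mul0r ?e ?subr0//.
by rewrite sub0r -opprB mulrN e mulNr.
Qed.

(** Each [clip] is affine on a cell, since its breakpoints are knots. *)
Lemma Ghat_between k s : (k < n.*2.+1)%N -> knot k <= s <= knot k.+1 ->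
  exists2 l : R, 0 <= l <= 1 &
    s = (1 - l) * knot k + l * knot k.+1 /\
    Ghat y s = (1 - l) * Ghat y (knot k) + l * Ghat y (knot k.+1).
Proof.
move=> kn /andP[ks sk].
have e : knot k.+1 - knot k = n%:R^-1 by rewrite knotB// subSnn mul1r.
pose l := (s - knot k) * n%:R.
have sE : s = (1 - l) * knot k + l * knot k.+1.
  rewrite (_ : _ + _ = knot k + l * (knot k.+1 - knot k)); last by ring.
  by rewrite e /l -mulrA mulfV ?gt_eqF// mulr1 addrC subrK.
exists l.
  rewrite /l mulr_ge0 ?subr_ge0//=.
  by rewrite -ler_pdivlMr// mul1r -e lerD2r.
split => //; rewrite !GhatE !mulr_sumr -big_split/=; apply: eq_bigr => j _.
suff : clip (knot j) (knot j.+1) s = (1 - l) * clip (knot j) (knot j.+1) (knot k)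
    + l * clip (knot j) (knot j.+1) (knot k.+1) by move=> ->; ring.
rewrite !clip_knot ltnS /clip; case: (ltngtP j k) => jk.
- have h : knot j.+1 <= s by rewrite (le_trans _ ks)// ler_knot.
  by rewrite (min_idPl h) (max_idPr _) ?ler_knot//; ring.
- have h : s <= knot j by rewrite (le_trans sk)// ler_knot.
  by rewrite (min_idPr _) ?(le_trans h) ?ler_knot// (max_idPl h); ring.
- by rewrite jk (min_idPr sk) (max_idPr ks).
Qed.

Lemma affine_minorant (phi : R -> R) : affine phi ->
  (forall k, (k <= n.*2.+1)%N -> phi (knot k) <= Ghat y (knot k)) ->
  forall s, s \in `[-1 - n%:R^-1, 1]%R -> phi s <= Ghat y s.
Proof.
move=> [a [b phiE]] le_knot s; rewrite in_itv/= -knot0 -knot_last => /andP[s0 s1].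
have ex : exists k, s <= knot k by exists n.*2.+1.
case: (ex_minnP ex) => k sk kmin.
have [k' [k'n /andP[ks sk']]] : exists k', (k' < n.*2.+1)%N /\ knot k' <= s <= knot k'.+1.
  case: k sk kmin => [|k] sk kmin.
    by exists 0%N; split => //; rewrite s0/= (le_trans sk)// ler_knot.
  exists k; split; first exact: kmin.
  by rewrite sk andbT leNgt; apply/negP => /ltW/kmin; rewrite ltnn.
have [l /andP[l0 l1] [-> ->]] := @Ghat_between k' s k'n (introT andP (conj ks sk')).
rewrite (_ : phi _ = (1 - l) * phi (knot k') + l * phi (knot k'.+1)); last first.
  by rewrite !phiE; ring.
by rewrite lerD// ler_wpM2l ?subr_ge0// le_knot// ltnW.
Qed.

Definition mean (a b : nat) : R :=
  (\sum_(i < n.*2.+1 | (a <= i < b)%N) tnth y i) / (b - a)%:R.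

Lemma cumB a b : (a < b)%N -> cum b - cum a = mean a b * (knot b - knot a).
Proof.
move=> ab; have ba : (b - a)%:R != 0 :> R by rewrite pnatr_eq0 subn_eq0 -ltnNge.
rewrite (knotB (ltnW ab)) /mean mulrA divfK// /cum -mulrBl; congr (_ / _).
rewrite big_mkcond [X in _ - X]big_mkcond [RHS]big_mkcond -sumrB/=.
apply: eq_bigr => i _; case: (ltnP i b) => ib; case: (ltnP i a) => ia;
  rewrite ?subrr ?subr0//.
by have := leq_trans ab ib; rewrite leqNgt (leq_trans ia).
Qed.

(** Apply [supporting_chord] to the graph of [Ghat] at the knots, with c in the
    middle of the cell that ends at 0.  The chord found lies below [Ghat]
    everywhere, hence is admissible in the definition of [Fhat]; any admissible
    affine function is below the chord at its two ends, hence between them.  So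
    [Fhat] is this chord on the whole cell, and [fhat y 0] is its slope.  The
    inequalities at the other knots are then inequalities between [fhat y 0] and
    slopes of chords, i.e., block means. *)
Lemma fhat_saddle : exists j l : 'I_n.+1,
  (forall l' : 'I_n.+1, fhat y 0 <= mean j (n.+1 + l')) /\
  (forall j' : 'I_n.+1, mean j' (n.+1 + l) <= fhat y 0).
Proof.
pose G k := Ghat y (knot k).
have [|||j [l [v [Gl Gr Gj]]]] := @supporting_chord R n.+1 knot G (- (2 * n%:R)^-1).
- move=> j jn; rewrite ltrNr.
  have h : knot j <= knot n by rewrite ler_knot.
  have := knotB (leqnSn n); rewrite knot_origin subSnn sub0r => e.
  apply: lt_le_trans (_ : n%:R^-1 <= _).
    by rewrite ltf_pV2 ?posrE ?mulr_gt0// ltr_pMl// ltr1n.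
  by rewrite -[leLHS]mul1r -e lerN2.
- move=> k _; apply: (@lt_le_trans _ _ 0).
    by rewrite oppr_lt0 invr_gt0 mulr_gt0.
  by rewrite -knot_origin ler_knot leq_addr.
- by [].
pose L t := G j + v * (t - knot j).
have Laff : affine L.
  by exists v, (G j - v * knot j) => t; rewrite /L; ring.
have Lle : forall s, s \in `[-1 - n%:R^-1, 1]%R -> L s <= Ghat y s.
  apply: affine_minorant => // k kn; have [kn'|nk] := ltnP k n.+1.
    exact: (Gj (Ordinal kn')).
  have kn'' : (k - n.+1 < n.+1)%N.
    by move: kn nk; rewrite -addnn; lia.
  by have := Gr (Ordinal kn''); rewrite /= subnKC.
have knot_in k : (k <= n.*2.+1)%N -> knot k \in `[-1 - n%:R^-1, 1]%R.
  by move=> kn; rewrite in_itv/= -knot0 -knot_last !ler_knot.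
set r := (n.+1 + l)%N.
have rn : (r <= n.*2.+1)%N by rewrite /r addSn -addnn ltnS leq_add2l -ltnS.
have jn : (j <= n.*2.+1)%N.
  by rewrite (leq_trans (leq_ord j))// -addnn leqW// leq_addr.
have FhatE t : knot j <= t <= knot r -> Fhat y t = L t.
  move=> /andP[jt tr].
  have ubL : ubound [set phi t | phi in [set phi | affine phi /\
      forall s, s \in `[-1 - n%:R^-1, 1] -> phi s <= Ghat y s]] (L t).
    move=> _ [phi [[a [b phiE]] phile] <-].
    have hj := phile _ (knot_in _ jn); have hr := phile _ (knot_in _ rn).
    have hj' : phi (knot j) <= L (knot j) by rewrite (le_trans hj)// /L subrr mulr0 addr0.
    have hr' : phi (knot r) <= L (knot r) by rewrite (le_trans hr)// /L -Gl.
    have jr : knot j < knot r by rewrite ltr_knot /r ltn_addr// ltn_ord.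
    have e (f : R -> R) : affine f ->
        f t * (knot r - knot j) = f (knot j) * (knot r - t) + f (knot r) * (t - knot j).
      by move=> [a' [b' fE]]; rewrite !fE; ring.
    rewrite -(@ler_pM2r _ (knot r - knot j)) ?subr_gt0// !e//; last by exists a, b.
    by rewrite lerD// ler_wpM2r ?subr_ge0.
  apply/eqP; rewrite eq_le; apply/andP; split.
    by apply: ge_sup => //; exists (L t), L.
  by apply: ub_le_sup; [exists (L t)|exists L].
have fhatE : fhat y 0 = v.
  rewrite /fhat; apply: lim_near_cst => //.
  have hn : 0 < n%:R^-1 :> R by rewrite invr_gt0.
  near=> h.
  have h0 : 0 < h by near: h; exact: nbhs_right_gt.
  have hlt : h < n%:R^-1 by near: h; exact: nbhs_right_lt.
  have r0 : 0 <= knot r by rewrite -knot_origin ler_knot leq_addr.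
  have j0 : knot j <= - n%:R^-1.
    have := knotB (leqnSn n); rewrite knot_origin subSnn sub0r mul1r => e.
    by rewrite -e opprK ler_knot -ltnS.
  rewrite !FhatE /L; [|lra|lra].
  by field; rewrite gt_eqF.
exists j, l; rewrite fhatE; split.
- move=> l'; have := Gr l'; rewrite /G !Ghat_knot -lerBrDl.
  rewrite [leRHS](_ : _ = cum (n.+1 + l') - cum j); last by ring.
  have jl : (j < n.+1 + l')%N by rewrite ltn_addr.
  by rewrite cumB// ler_pM2r// subr_gt0 ltr_knot.
- move=> j'.
  have jl : (j' < n.+1 + l)%N by rewrite ltn_addr.
  rewrite -(@ler_pM2r _ (knot (n.+1 + l) - knot j')) ?subr_gt0 ?ltr_knot// -cumB//.
  by have := Gj j'; move: Gl; rewrite /G !Ghat_knot; lra.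
Unshelve. all: by end_near.
Qed.

End envelope.

(** * Tail events of the estimator *)

Section fhat_events.
Context {R : realType} (n : nat).
Hypothesis n_gt0 : (0 < n)%N.

(** [fhat y 0 >= c] and [fhat y 0 <= c] become finite combinations of linear
    inequalities in the data; this gives both the measurability of the events
    and the bounds of their probabilities. *)
Lemma fhat_ge (y : n.*2.+1.-tuple R) c : (c <= fhat y 0) <->
  exists j : 'I_n.+1, forall l : 'I_n.+1, c <= mean y j (n.+1 + l).
Proof.
have [j [l [hj hl]]] := fhat_saddle y n_gt0; split.
  by move=> cf; exists j => l'; exact: le_trans cf (hj l').
by move=> [j' h]; exact: le_trans (h l) (hl j').
Qed.

Lemma fhat_le (y : n.*2.+1.-tuple R) c : (fhat y 0 <= c) <->
  exists l : 'I_n.+1, forall j : 'I_n.+1, mean y j (n.+1 + l) <= c.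
Proof.
have [j [l [hj hl]]] := fhat_saddle y n_gt0; split.
  by move=> fc; exists l => j'; exact: le_trans (hl j') fc.
by move=> [l' h]; exact: le_trans (hj l') (h j).
Qed.

Lemma measurable_mean a b :
  measurable_fun [set: n.*2.+1.-tuple R] (fun y => mean y a b).
Proof.
apply: measurable_funM => //.
under eq_fun do rewrite big_mkcond.
apply: measurable_sum => i; case: (_ <= _ < _)%N => //; exact: measurable_tnth.
Qed.

Lemma measurable_fhat_ge c : measurable [set y : n.*2.+1.-tuple R | c <= fhat y 0].
Proof.
rewrite (_ : [set _ | _] = \bigcup_(j in [set: 'I_n.+1]) \bigcap_(l in [set: 'I_n.+1])
   ((fun y => mean y j (n.+1 + l)) @^-1` `[c, +oo[)).
  apply: fin_bigcup_measurable => // j _; apply: fin_bigcap_measurable => // l _.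
  by rewrite -[X in measurable X]setTI; exact: measurable_mean.
apply/seteqP; split => y /=.
  by move=> /fhat_ge[j h]; exists j => // l _ /=; rewrite in_itv/= andbT.
move=> [j _ h]; apply/fhat_ge; exists j => l.
by have := h l I; rewrite /= in_itv/= andbT.
Qed.

Lemma measurable_fhat_le c : measurable [set y : n.*2.+1.-tuple R | fhat y 0 <= c].
Proof.
rewrite (_ : [set _ | _] = \bigcup_(l in [set: 'I_n.+1]) \bigcap_(j in [set: 'I_n.+1])
   ((fun y => mean y j (n.+1 + l)) @^-1` `]-oo, c])).
  apply: fin_bigcup_measurable => // j _; apply: fin_bigcap_measurable => // l _.
  by rewrite -[X in measurable X]setTI; exact: measurable_mean.
apply/seteqP; split => y /=.
  by move=> /fhat_le[j h]; exists j => // l _ /=; rewrite in_itv/=.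
move=> [j _ h]; apply/fhat_le; exists j => l.
by have := h l I; rewrite /= in_itv/=.
Qed.

Lemma observeE f (e : n.*2.+1.-tuple R) i :
  tnth (observe f e) i = f (knot n i.+1) + tnth e i.
Proof. by rewrite tnth_mktuple design_right. Qed.

Lemma mean_observe f (e : n.*2.+1.-tuple R) a b : mean (observe f e) a b =
  @mean R n [tuple f (knot n i.+1) | i < n.*2.+1] a b + mean e a b.
Proof.
rewrite /mean -mulrDl -big_split/=; congr (_ / _); apply: eq_bigr => i _.
by rewrite observeE tnth_mktuple.
Qed.

Lemma card_block a b : (a <= b)%N -> (b <= n.*2.+1)%N ->
  \sum_(i < n.*2.+1 | (a <= i < b)%N) (1 : R) = (b - a)%:R.
Proof.
move=> ab bn; rewrite -(big_mkord (fun i => (a <= i < b)%N) (fun=> 1)).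
rewrite (@big_cat_nat _ _ _ b)//= [X in _ + X]big_nat_cond.
rewrite [X in _ + X]big_pred0 ?addr0; last first.
  by move=> i; case: (ltnP i b); rewrite ?andbF//.
rewrite (@big_cat_nat _ _ _ a)//= [X in X + _]big_nat_cond.
rewrite [X in X + _]big_pred0 ?add0r; last first.
  by move=> i; case: (ltnP i a); rewrite ?andbF//.
rewrite big_nat_cond (eq_bigl (fun i => (a <= i < b)%N)).
  by rewrite -big_nat sumr_const_nat.
by move=> i; rewrite andbb.
Qed.

Lemma mean_le (y : n.*2.+1.-tuple R) a b c : (a < b)%N -> (b <= n.*2.+1)%N ->
  (forall i : 'I_n.*2.+1, (a <= i < b)%N -> tnth y i <= c) -> mean y a b <= c.
Proof.
move=> ab bn h; rewrite /mean ler_pdivrMr ?ltr0n ?subn_gt0//.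
by rewrite -card_block// 1?ltnW// mulr_sumr; apply: ler_sum => i /h; rewrite mulr1.
Qed.

Lemma mean_ge (y : n.*2.+1.-tuple R) a b c : (a < b)%N -> (b <= n.*2.+1)%N ->
  (forall i : 'I_n.*2.+1, (a <= i < b)%N -> c <= tnth y i) -> c <= mean y a b.
Proof.
move=> ab bn h; rewrite /mean ler_pdivlMr ?ltr0n ?subn_gt0//.
by rewrite -card_block// 1?ltnW// mulr_sumr; apply: ler_sum => i /h; rewrite mulr1.
Qed.

End fhat_events.

(** * One-sided error bounds *)

Section one_sided.
Context {R : realType}.
Variables (mu : probability R R) (sigma : R).
Hypothesis mu_mean : ('E_mu[idfun] = 0)%E.
Hypothesis mu_var : ('V_mu[idfun] = (sigma ^+ 2)%:E)%E.

(** The first N terms are 1 / N; the others are dominated by the telescoping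
    series of N / k - N / (k + 1).  The induction has to follow both regimes. *)
Lemma sum_inv_sqr_le (N m : nat) : (0 < N)%N ->
  \sum_(k < m) N%:R / (maxn N k.+1)%:R ^+ 2 <= 2 :> R.
Proof.
move=> N0.
have NR : 0 < N%:R :> R by rewrite ltr0n.
suff h : if (m <= N)%N then \sum_(k < m) N%:R / (maxn N k.+1)%:R ^+ 2 <= m%:R / N%:R :> R
         else \sum_(k < m) N%:R / (maxn N k.+1)%:R ^+ 2 <= 2 - N%:R / m%:R :> R.
  case: ifP h => [mN|_] h; apply: (le_trans h).
    by rewrite ler_pdivrMr// -natrM ler_nat (leq_trans mN)// mul2n -addnn leq_addr.
  by rewrite gerBl divr_ge0.
elim: m => [|m IH]; first by rewrite leq0n big_ord0 mul0r.
rewrite big_ord_recr/=; case: ifPn => mN.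
  rewrite (leq_trans (leqnSn m) mN) in IH.
  rewrite (maxn_idPl mN) -[m.+1]addn1 natrD mulrDl lerD//.
  by rewrite expr2 invfM mulrA mulfV ?gt_eqF.
rewrite -ltnNge ltnS in mN.
rewrite (maxn_idPr (leqW mN)).
have mR : 0 < m%:R :> R by rewrite ltr0n (leq_trans N0).
have step : N%:R / m.+1%:R ^+ 2 <= N%:R / m%:R - N%:R / m.+1%:R :> R.
  rewrite -mulrBr ler_wpM2l// -[m.+1]addn1 natrD.
  rewrite (_ : _ - _ = (m%:R * (m%:R + 1))^-1); last first.
    by field; rewrite !gt_eqF// addr_gt0.
  rewrite lef_pV2 ?posrE ?exprn_gt0 ?mulr_gt0 ?addr_gt0// expr2.
  by rewrite ler_pM2r ?addr_gt0// lerDl.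
have IH' : \sum_(k < m) N%:R / (maxn N k.+1)%:R ^+ 2 <= 2 - N%:R / m%:R :> R.
  move: IH; case: ifPn => // Nm; have -> : m = N by apply/eqP; rewrite eqn_leq Nm mN.
  by rewrite mulfV ?gt_eqF// => ?; lra.
by apply: (le_trans (lerD IH' step)); rewrite addrA subrK.
Qed.

(** [maximal_inequality] with weights constant up to N and then decreasing like
    N / (C k)^2, so that crossing after N terms says that an average of k terms
    reaches C / sqrt N. *)
Lemma long_average_bound (m M N : nat) (p : 'I_m -> 'I_M) (C : R) (B : set (M.-tuple R)) :
  injective p -> measurable B -> 0 < C -> (0 < N)%N ->
  (forall e, B e -> exists k : 'I_m, (N <= k.+1)%N /\
     k.+1%:R * (C / Num.sqrt N%:R) <= `|\sum_(i < m | (i <= k)%N) tnth e (p i)|) ->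
  (iid_law mu M B <= (2 * sigma ^+ 2 / C ^+ 2)%:E)%E.
Proof.
move=> p_inj mB C0 N0 hB.
have NR : 0 < N%:R :> R by rewrite ltr0n.
(* Index k stands for k + 1 terms. *)
pose w (k : nat) : R := N%:R / (maxn N k.+1)%:R ^+ 2 / C ^+ 2.
have maxR k : 0 < (maxn N k.+1)%:R :> R by rewrite ltr0n leq_max N0.
have w0 k : 0 <= w k by rewrite /w !divr_ge0// sqr_ge0.
have wn k : w k.+1 <= w k.
  rewrite /w ler_wpM2r ?invr_ge0 ?sqr_ge0// ler_wpM2l//.
  rewrite lef_pV2 ?posrE ?exprn_gt0// ler_pXn2r ?nnegrE ?ler0n// ler_nat.
  by rewrite geq_max leq_maxl leq_max leqnSn orbT.
apply: (@le_trans _ _ (iid_law mu M (sub_sample p @^-1` crosses w 0))).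
  apply: le_measure; rewrite ?inE//.
    rewrite -[X in measurable X]setTI; apply: measurable_sub_sample => //.
    exact: measurable_crosses.
  move=> e /hB[k [Nk h]]; exists k; rewrite add0r.
  under eq_bigr do rewrite tnth_mktuple.
  rewrite /w (maxn_idPr Nk); move: h; set S := \sum_(_ < _ | _) _ => h.
  have k0 : 0 < k.+1%:R :> R by rewrite ltr0n.
  have s0 : 0 < Num.sqrt N%:R :> R by rewrite sqrtr_gt0.
  have h2 : (k.+1%:R * (C / Num.sqrt N%:R)) ^+ 2 <= S ^+ 2.
    rewrite -[leRHS]real_normK ?num_real// ler_pXn2r// nnegrE.
    by rewrite mulr_ge0// divr_ge0 ?(ltW C0)// ltW.
  move: h2; rewrite exprMn expr_div_n sqr_sqrtr ?(ltW NR)// => h2.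
  apply: (@le_trans _ _ (N%:R / k.+1%:R ^+ 2 / C ^+ 2 * (k.+1%:R ^+ 2 * (C ^+ 2 / N%:R)))).
    by rewrite le_eqVlt; apply/orP; left; apply/eqP; field; rewrite !gt_eqF.
  by rewrite ler_wpM2l// !divr_ge0// sqr_ge0.
rewrite (iid_law_sub_sample mu p_inj (@measurable_crosses _ _ _ _)).
apply: le_trans; first exact: (@maximal_inequality _ _ _ mu_mean mu_var m w 0 w0 wn).
rewrite lee_fin expr0n/= mulr0 add0r /w -mulr_suml mulrA ler_wpM2r ?invr_ge0 ?sqr_ge0//.
by rewrite mulrC ler_wpM2r ?sqr_ge0// sum_inv_sqr_le.
Qed.

Variables (n : nat) (f : R -> R) (C gamma : R).
Hypothesis n_gt0 : (0 < n)%N.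
Hypothesis f_nd : {in `[-1, 1]%R &, {homo f : x y / x <= y}}.
Hypothesis C_gt0 : 0 < C.

Let nR : 0 < n%:R :> R. Proof. by rewrite ltr0n. Qed.

Lemma data_lawE A :
  data_law mu n f A = iid_law mu n.*2.+1 (@observe R n f @^-1` A).
Proof. by []. Qed.

Lemma measurable_observe_preimage (A : set (n.*2.+1.-tuple R)) : measurable A ->
  measurable (@observe R n f @^-1` A).
Proof.
by move=> mA; rewrite -[X in measurable X]setTI; exact: measurable_observe.
Qed.

Lemma knot_in (k : nat) : (0 < k <= n.*2.+1)%N -> @knot R n k \in `[-1, 1]%R.
Proof.
move=> /andP[k0 kn]; rewrite in_itv/=.
have -> : -1 = @knot R n 1 by rewrite /knot -[n.+1]addn1 natrD; field; rewrite gt_eqF.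
by rewrite -[X in _ && (_ <= X)](knot_last n_gt0) !ler_knot// k0.
Qed.

(** If [fhat y 0] is at least f 0 + gamma, some block with right end l / n has a
    mean at least that large.  By monotonicity f contributes at most f (l / n), so
    the noise contributes at least C / sqrt (l + 1), with at least l + 1 terms.
    The noise is summed leftwards from l / n, whence the reversed numbering p. *)
Lemma overestimation_bound (l : 'I_n.+1) :
  f (l%:R / n%:R) - f 0 + C / Num.sqrt l.+1%:R <= gamma ->
  (data_law mu n f [set y | (f 0 + gamma <= fhat y 0)%R] <=
    (2 * sigma ^+ 2 / C ^+ 2)%:E)%E.
Proof.
move=> hl; pose r := (n.+1 + l)%N.
have rn : (r <= n.*2.+1)%N by rewrite /r addSn -addnn ltnS leq_add2l -ltnS.
have p_lt (i : 'I_r) : (r - i.+1 < n.*2.+1)%N by have := ltn_ord i; lia.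
pose p (i : 'I_r) : 'I_n.*2.+1 := Ordinal (p_lt i).
have p_inj : injective p.
  move=> i j /(congr1 val)/= h; apply/val_inj => /=.
  by have := ltn_ord i; have := ltn_ord j; lia.
rewrite data_lawE.
apply: (@long_average_bound r n.*2.+1 l.+1 p C _ p_inj) => //.
  apply: measurable_observe_preimage.
  exact: measurable_fhat_ge.
move=> e /= /(fhat_ge n_gt0)[j /(_ l)]; rewrite -/r => h.
have jn : (j <= n)%N by rewrite -ltnS.
have jr : (j < r)%N by rewrite /r; lia.
have k_lt : (r - j.+1 < r)%N by lia.
exists (Ordinal k_lt); split; first by rewrite /= /r; lia.
have sumE : \sum_(i < r | (i <= r - j.+1)%N) tnth e (p i) =
    \sum_(i < n.*2.+1 | (j <= i < r)%N) tnth e i.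
  rewrite (reindex_omap p (fun i => insub (r - i.+1)%N)); last first.
    move=> i /andP[ji ir]; case: insubP => [k _ /= kE|]; last by rewrite -ltnNge; lia.
    by congr Some; apply/val_inj => /=; rewrite kE; lia.
  apply: eq_bigl => i /=; have := ltn_ord i => ir.
  case: insubP => [k _ /= kE|]; last by lia.
  have -> : k = i by apply/val_inj => /=; rewrite kE; lia.
  by rewrite eqxx andbT; lia.
rewrite sumE (_ : (Ordinal k_lt).+1 = r - j)%N /=; last by lia.
move: h; rewrite mean_observe => h.
have fle : @mean R n [tuple f (knot n i.+1) | i < n.*2.+1] j r <= f (l%:R / n%:R).
  apply: mean_le => // i /andP[ji ir]; rewrite tnth_mktuple.
  rewrite (_ : l%:R / n%:R = knot n r); last first.
    by rewrite /knot /r natrD addrC addKr.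
  by apply: f_nd; [apply: knot_in; lia|apply: knot_in; lia|rewrite ler_knot].
have : C / Num.sqrt l.+1%:R <= mean e j r by lra.
rewrite /mean ler_pdivlMr ?ltr0n ?subn_gt0// mulrC => /le_trans; apply.
exact: ler_norm.
Qed.

(** Mirror image of [overestimation_bound]: the left end - l / n of the blocks is
    fixed and the noise is summed rightwards. *)
Lemma underestimation_bound (l : 'I_n.+1) :
  f 0 - f (- (l%:R / n%:R)) + C / Num.sqrt l.+1%:R <= gamma ->
  (data_law mu n f [set y | (fhat y 0 <= f 0 - gamma)%R] <=
    (2 * sigma ^+ 2 / C ^+ 2)%:E)%E.
Proof.
move=> hl; have ln : (l <= n)%N by rewrite -ltnS.
pose a := (n - l)%N; pose m := (n.*2.+1 - a)%N.
have p_lt (i : 'I_m) : (a + i < n.*2.+1)%N by have := ltn_ord i; rewrite /m; lia.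
pose p (i : 'I_m) : 'I_n.*2.+1 := Ordinal (p_lt i).
have p_inj : injective p.
  by move=> i j /(congr1 val)/= h; apply/val_inj => /=; lia.
rewrite data_lawE.
apply: (@long_average_bound m n.*2.+1 l.+1 p C _ p_inj) => //.
  apply: measurable_observe_preimage.
  exact: measurable_fhat_le.
have a_lt : (a < n.+1)%N by rewrite /a; lia.
move=> e /= /(fhat_le n_gt0)[l' /(_ (Ordinal a_lt))] /=.
set r := (n.+1 + l')%N => h.
have l'n : (l' <= n)%N by rewrite -ltnS.
have rn : (r <= n.*2.+1)%N by rewrite /r -addnn; lia.
have ar : (a < r)%N by rewrite /r; lia.
have k_lt : (r - a.+1 < m)%N by rewrite /m; lia.
exists (Ordinal k_lt); split; first by rewrite /= /r /a; lia.
have sumE : \sum_(i < m | (i <= r - a.+1)%N) tnth e (p i) =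
    \sum_(i < n.*2.+1 | (a <= i < r)%N) tnth e i.
  rewrite (reindex_omap p (fun i => insub (i - a)%N)); last first.
    move=> i /andP[ai ir]; case: insubP => [k _ /= kE|]; last first.
      by rewrite -ltnNge; have := ltn_ord i; lia.
    by congr Some; apply/val_inj => /=; rewrite kE; lia.
  apply: eq_bigl => i /=; have := ltn_ord i => im.
  case: insubP => [k _ /= kE|]; last by lia.
  have -> : k = i by apply/val_inj => /=; rewrite kE; lia.
  by rewrite eqxx andbT; lia.
rewrite sumE (_ : (Ordinal k_lt).+1 = r - a)%N /=; last by lia.
move: h; rewrite mean_observe => h.
have fge : f (- (l%:R / n%:R)) <= @mean R n [tuple f (knot n i.+1) | i < n.*2.+1] a r.
  apply: mean_ge => // i /andP[ai ir]; rewrite tnth_mktuple.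
  rewrite (_ : - (l%:R / n%:R) = knot n a.+1); last first.
    by rewrite /knot /a -subSn// natrB ?leqW// -mulNr; congr (_ / _); ring.
  by apply: f_nd; [apply: knot_in; lia|apply: knot_in; lia|rewrite ler_knot].
have : C / Num.sqrt l.+1%:R <= - mean e a r by lra.
rewrite /mean -mulNr ler_pdivlMr ?ltr0n ?subn_gt0// mulrC => /le_trans; apply.
by rewrite -normrN ler_norm.
Qed.

End one_sided.

(** * An alternative that is hard to distinguish *)

Section perturbation.
Context {R : realType}.

(** The hypotheses of [overestimation_bound] and [underestimation_bound], with
    prescribed ends r / n and - l / n. *)
Definition accurate_at (n : nat) (C gamma : R) (f : R -> R) (r l : 'I_n.+1) :=
  f (r%:R / n%:R) - f 0 + C / Num.sqrt r.+1%:R <= gamma /\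
  f 0 - f (- (l%:R / n%:R)) + C / Num.sqrt l.+1%:R <= gamma.

(** The ends r, l are common to f0 and f1, and the bound on the squared distance
    over the design depends on the constants only. *)
Definition hard_alternative (n : nat) (C c : R) (f0 f1 : R -> R) (gamma : R) :=
  exists r l : 'I_n.+1,
  [/\ {in `[-1, 1]%R &, {homo f1 : x y / x <= y}} /\ 0 < gamma,
      accurate_at C gamma f0 r l,
      accurate_at C gamma f1 r l,
      c * gamma <= 2 * `|f1 0 - f0 0| &
      \sum_(i < n.*2.+1) (f1 (design n (sample_index i)) -
         f0 (design n (sample_index i))) ^+ 2 <= 4 * c ^+ 2 * C ^+ 2].

Lemma count_le (n m : nat) (X : R) : 0 <= X ->
  \sum_(i < m) ((n <= i)%N && ((i - n).+1%:R <= X))%:R <= X.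
Proof.
move=> X0.
suff [] : \sum_(i < m) ((n <= i)%N && ((i - n).+1%:R <= X))%:R <= X /\
  \sum_(i < m) ((n <= i)%N && ((i - n).+1%:R <= X))%:R <= (m - n)%:R :> R by [].
elim: m => [|m [IHX IHm]]; first by rewrite big_ord0.
rewrite big_ord_recr/=; case: (leqP n m) => nm /=; last first.
  by rewrite addr0; split => //; apply: (le_trans IHm); rewrite ler_nat leq_sub2r.
case: (leP (m - n).+1%:R X) => h /=; last first.
  by rewrite addr0; split => //; apply: (le_trans IHm); rewrite ler_nat leq_sub2r.
have e : \sum_(i < m) ((n <= i)%N && ((i - n).+1%:R <= X))%:R + 1 <= (m - n).+1%:R :> R.
  by rewrite -natr1 lerD2r.
by split; [exact: le_trans e h|rewrite subSn].
Qed.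

Lemma design_shift (n : nat) (i : 'I_n.*2.+1) : (n <= i)%N ->
  design n (sample_index i) = (i - n)%:R / n%:R :> R.
Proof.
by move=> ni; rewrite /design /sample_index natrB// rmorphB/= -!pmulrn.
Qed.

Lemma design_lt0 (n : nat) (i : 'I_n.*2.+1) : (i < n)%N ->
  design n (sample_index i) < 0 :> R.
Proof.
move=> ni; rewrite /design /sample_index rmorphB/= -!pmulrn.
rewrite ltr_pdivrMr ?mul0r ?subr_lt0 ?ltr_nat// ltr0n; exact: leq_ltn_trans ni.
Qed.

Lemma grid_in (n : nat) (i : 'I_n.+1) : (0 < n)%N ->
  0 <= (i%:R / n%:R : R) <= 1.
Proof.
move=> n0; rewrite divr_ge0//= ler_pdivrMr ?ltr0n// mul1r ler_nat.
by rewrite -ltnS.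
Qed.

(** The case where the right side determines the rate; u is the optimal bound on
    that side, attained at r.  Raising f0 to f0 0 + delta on the right of 0
    changes few design points, by optimality of u. *)
Lemma upward_alternative (n : nat) (C c : R) (f0 : R -> R) :
  (0 < n)%N -> 0 < C -> 0 < c <= 1 / 2 ->
  {in `[-1, 1]%R &, {homo f0 : x y / x <= y}} ->
  forall r l : 'I_n.+1,
  (forall q : 'I_n.+1, f0 (r%:R / n%:R) - f0 0 + C / Num.sqrt r.+1%:R <=
                 f0 (q%:R / n%:R) - f0 0 + C / Num.sqrt q.+1%:R) ->
  f0 0 - f0 (- (l%:R / n%:R)) + C / Num.sqrt l.+1%:R <=
    f0 (r%:R / n%:R) - f0 0 + C / Num.sqrt r.+1%:R ->
  exists f1 gamma, hard_alternative n C c f0 f1 gamma.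
Proof.
move=> n0 C0 /andP[c0 c_half] nd r l.
set u := f0 (r%:R / n%:R) - f0 0 + C / Num.sqrt r.+1%:R => rmin lu.
have in01 (x : R) : 0 <= x <= 1 -> x \in `[-1, 1]%R.
  by move=> /andP[x0 x1]; rewrite in_itv/= x1 andbT (le_trans _ x0)// lerN10.
have f0_right (q : 'I_n.+1) : f0 0 <= f0 (q%:R / n%:R).
  have /andP[q0 q1] := grid_in q n0.
  by apply: nd => //; apply: in01; rewrite ?q0 ?q1 ?lexx ?ler01.
have root0 (q : 'I_n.+1) : 0 < Num.sqrt q.+1%:R :> R by rewrite sqrtr_gt0 ltr0n.
have u0 : 0 < u.
  by rewrite /u ltr_wpDl ?subr_ge0// divr_gt0.
pose delta := c * u.
have delta0 : 0 < delta by rewrite mulr_gt0.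
have delta_u : delta <= u.
  by rewrite /delta ler_piMl ?(ltW u0)//; lra.
pose f1 x := if 0 <= x then Num.max (f0 x) (f0 0 + delta) else f0 x.
have f10 : f1 0 = f0 0 + delta.
  by rewrite /f1 lexx; apply/max_idPr; rewrite lerDl ltW.
have f01 x : f0 x <= f1 x by rewrite /f1; case: ifP => // _; rewrite le_max lexx.
exists f1, (2 * u), r, l; split.
- split; last by rewrite mulr_gt0.
  move=> x y xI yI xy; rewrite /f1; case: (leP 0 x) => x0.
    rewrite (le_trans x0 xy) ge_max !le_max lexx orbT andbT.
    by rewrite nd.
  by case: ifP => _; rewrite ?le_max nd.
- by split; [rewrite -/u; lra|lra].
- split.
    rewrite f10 /f1; have /andP[-> _] := grid_in r n0.
    have : Num.max (f0 (r%:R / n%:R)) (f0 0 + delta) <= f0 (r%:R / n%:R) + delta.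
      by rewrite ge_max lerDl (ltW delta0)/= lerD2r.
    by move: (delta_u); rewrite /u; lra.
  rewrite f10; have := f01 (- (l%:R / n%:R)); lra.
- by rewrite f10 addrAC subrr add0r gtr0_norm// /delta; lra.
(* X bounds the number of design points where f1 differs from f0, each of which
   contributes delta ^+ 2 at most. *)
- pose X := 4 * C ^+ 2 / u ^+ 2.
  have X0 : 0 <= X by rewrite divr_ge0 ?sqr_ge0// mulr_ge0 ?sqr_ge0.
  have -> : 4 * c ^+ 2 * C ^+ 2 = delta ^+ 2 * X.
    by rewrite /delta /X; field; rewrite gt_eqF.
  apply: (@le_trans _ _ (delta ^+ 2 * \sum_(i < n.*2.+1)
      ((n <= i)%N && ((i - n).+1%:R <= X))%:R)); last first.
    by rewrite ler_wpM2l ?sqr_ge0// count_le.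
  rewrite mulr_sumr; apply: ler_sum => i _.
  have [ni|ni] := leqP n i; last first.
    by rewrite /f1 [0 <= _]leNgt design_lt0//= subrr expr0n/= mulr0.
  rewrite design_shift//=.
  have q_lt : (i - n < n.+1)%N by rewrite ltn_subLR// addnS addnn.
  pose q := Ordinal q_lt.
  have := f0_right q; have := rmin q; rewrite /= => qu q0.
  rewrite /f1 (_ : 0 <= (i - n)%:R / n%:R); last by rewrite divr_ge0.
  have [h|h] := leP (f0 0 + delta) (f0 ((i - n)%:R / n%:R)).
    by rewrite subrr expr0n/= mulr_ge0 ?sqr_ge0.
  have sN := root0 q; rewrite /= in sN.
  have us : u * Num.sqrt (i - n).+1%:R <= 2 * C.
    rewrite -ler_pdivlMr//.
    have : (1 - c) * u <= C / Num.sqrt (i - n).+1%:R by move: qu h; rewrite /delta; lra.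
    move=> h1; rewrite -mulrA; set z := C / _ in h1 *.
    have : u / 2 <= (1 - c) * u.
      by rewrite mulrC ler_wpM2r ?(ltW u0)//; lra.
    by move: h1; lra.
  have -> : (i - n).+1%:R <= X.
    rewrite /X ler_pdivlMr ?exprn_gt0//.
    rewrite -[(i - n).+1%:R](@sqr_sqrtr R) ?ler0n// -exprMn.
    rewrite (_ : 4 * C ^+ 2 = (2 * C) ^+ 2); last by ring.
    rewrite ler_pXn2r ?nnegrE ?mulr_ge0 ?(ltW C0) ?(ltW u0) ?(ltW sN)//.
    by rewrite mulrC.
  rewrite mulr1 ler_pXn2r ?nnegrE ?(ltW delta0) ?subr_ge0 ?(ltW h)//.
  by lra.
Qed.

(** If the left side determines the rate, [upward_alternative] applies to
    x |-> - f0 (- x). *)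
Lemma exists_hard_alternative (n : nat) (C c : R) (f0 : R -> R) :
  (0 < n)%N -> 0 < C -> 0 < c <= 1 / 2 ->
  {in `[-1, 1]%R &, {homo f0 : x y / x <= y}} ->
  exists f1 gamma, hard_alternative n C c f0 f1 gamma.
Proof.
move=> n0 C0 cr nd.
pose right (f : R -> R) (q : 'I_n.+1) : R :=
  f (q%:R / n%:R) - f 0 + C / Num.sqrt q.+1%:R.
pose left (f : R -> R) (q : 'I_n.+1) : R :=
  f 0 - f (- (q%:R / n%:R)) + C / Num.sqrt q.+1%:R.
have [r _ /= rmin] := @arg_minP _ _ _ (ord0 : 'I_n.+1) predT (right f0) isT.
have [l _ /= lmin] := @arg_minP _ _ _ (ord0 : 'I_n.+1) predT (left f0) isT.
have [lr|rl] := leP (left f0 l) (right f0 r).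
  by apply: (@upward_alternative n C c f0 n0 C0 cr nd r l) => // q; exact: rmin.
pose g0 x := - f0 (- x).
have symI (x : R) : x \in `[-1, 1]%R -> - x \in `[-1, 1]%R.
  by rewrite !in_itv/= => /andP[? ?]; apply/andP; split; lra.
have g0_nd : {in `[-1, 1]%R &, {homo g0 : x y / x <= y}}.
  move=> x y xI yI xy; by rewrite /g0 lerN2 nd ?lerN2// symI.
have gright (q : 'I_n.+1) :
    g0 (q%:R / n%:R) - g0 0 + C / Num.sqrt q.+1%:R = left f0 q.
  by rewrite /g0 /left oppr0; ring.
have gleft (q : 'I_n.+1) :
    g0 0 - g0 (- (q%:R / n%:R)) + C / Num.sqrt q.+1%:R = right f0 q.
  by rewrite /g0 /right oppr0 !opprK; ring.
have [||g1 [gamma [r' [l' [[g1_nd gamma0] g0acc g1acc sep close]]]]] :=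
    @upward_alternative n C c g0 n0 C0 cr g0_nd l r.
- by move=> q; rewrite !gright; exact: lmin.
- by rewrite gleft gright ltW.
have reflect_acc g : accurate_at C gamma g r' l' ->
    accurate_at C gamma (fun x => - g (- x)) l' r'.
  move=> [gr gl]; split; rewrite oppr0 ?opprK; [move: gl|move: gr];
    by apply: le_trans; rewrite le_eqVlt; apply/orP; left; apply/eqP; ring.
exists (fun x => - g1 (- x)), gamma, l', r'; split => //.
- split => // x y xI yI xy; by rewrite lerN2 g1_nd ?lerN2// symI.
- have := reflect_acc g0 g0acc; rewrite (_ : (fun x => - g0 (- x)) = f0)//.
  by apply/funext => x; rewrite /g0 !opprK.
- exact: reflect_acc.
- rewrite oppr0 (_ : - g1 0 - f0 0 = - (g1 0 - g0 0)) ?normrN//.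
  by rewrite /g0 oppr0; ring.
- rewrite (reindex_inj rev_ord_inj)/=; apply: le_trans close.
  rewrite le_eqVlt; apply/orP; left; apply/eqP; apply: eq_bigr => i _.
  have -> : design n (sample_index (rev_ord i)) = - design n (sample_index i) :> R.
    rewrite /design /sample_index -mulNr; congr (_ / _).
    rewrite !rmorphB/= -!pmulrn natrB//.
    have -> : n.*2.+1%:R = n%:R + n%:R + 1 :> R by rewrite -natr1 -addnn natrD.
    by rewrite -(natr1 i); ring.
  by rewrite opprK /g0; ring.
Qed.

End perturbation.

(** * Risk bounds *)

Section limits.
Context {R : realType}.
Implicit Type u : nat -> \bar R.

Lemma limn_esup_le u (l : \bar R) :
  (forall n, (0 < n)%N -> (u n <= l)%E) -> (limn_esup u <= l)%E.
Proof.
move=> ul; apply: (@le_trans _ _ (ereal_sup (u @` [set n | (0 < n)%N]))).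
  by apply: ereal_inf_lbound; exists [set n | (0 < n)%N] => //; exists 1%N.
by apply: ge_ereal_sup => _ [n /= n0 <-]; exact: ul.
Qed.

Lemma le_limn_einf u (l : \bar R) :
  (forall n, (0 < n)%N -> (l <= u n)%E) -> (l <= limn_einf u)%E.
Proof.
move=> lu; rewrite leeNr; apply: limn_esup_le => n n0.
by rewrite leeN2 lu.
Qed.

End limits.

Section risk_bounds.
Context {R : realType}.
Variables (mu : probability R R) (phi : R -> R) (sigma M : R).
Hypothesis mu_mean : ('E_mu[idfun] = 0)%E.
Hypothesis mu_var : ('V_mu[idfun] = (sigma ^+ 2)%:E)%E.
Hypothesis mu_density : has_density mu phi.
Hypothesis M_gt0 : 0 < M.
Hypothesis phi_hellinger : forall a : R,
  (\int[lebesgue_measure]_y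
      ((Num.sqrt (phi (y - a)) - Num.sqrt (phi y)) ^+ 2)%:E
    <= (M * a ^+ 2)%:E)%E.

Lemma fhat_error_bound n (C gamma : R) f (r l : 'I_n.+1) : (0 < n)%N -> 0 < C ->
  {in `[-1, 1]%R &, {homo f : x y / x <= y}} ->
  accurate_at C gamma f r l ->
  (data_law mu n f [set y | (gamma <= `|fhat y 0 - f 0|)%R] <=
    (4 * sigma ^+ 2 / C ^+ 2)%:E)%E.
Proof.
move=> n0 C0 nd [hr hl].
rewrite (_ : [set y | _] = [set y | f 0 + gamma <= fhat y 0] `|`
    [set y | fhat y 0 <= f 0 - gamma]); last first.
  apply/seteqP; split => y /=; rewrite ler_normr.
    by move=> /orP[h|h]; [left|right]; lra.
  by move=> [h|h]; apply/orP; [left|right]; lra.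
apply: (le_trans (measureU2 _ _ _)).
- exact: measurable_fhat_ge.
- exact: measurable_fhat_le.
rewrite (_ : 4 * sigma ^+ 2 / C ^+ 2 =
  2 * sigma ^+ 2 / C ^+ 2 + 2 * sigma ^+ 2 / C ^+ 2); last by field; rewrite gt_eqF.
rewrite EFinD; apply: leeD.
- exact: (overestimation_bound mu_mean mu_var n0 nd C0 hr).
- exact: (underestimation_bound mu_mean mu_var n0 nd C0 hl).
Qed.

(** The choice s = 2 - tau, t = 1 / s in [product_affinity_ge]: if the sum of
    errors e were smaller than tau, the right-hand side
    s * e + (2 - e) / s would be smaller than 2 - (1 - tau)^2. *)
Lemma testing_error_ge m (D : nat -> R) (B : set (m.-tuple R)) (tau : R) :
  measurable B -> 0 < tau < 1 ->
  M * \sum_(i < m) D i ^+ 2 < (1 - tau) ^+ 2 ->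
  (tau%:E <= iid_law mu m B + iid_law mu m (perturb D @^-1` (~` B)))%E.
Proof.
move=> mB /andP[tau0 tau1] small.
have s0 : 0 < 2 - tau by lra.
have si0 : 0 < (2 - tau)^-1 by rewrite invr_gt0.
have := product_affinity_ge mu_density M_gt0 phi_hellinger D mB s0 si0.
have mQB := measurable_preimage_perturb D mB.
have PC : (iid_law mu m (~` B) = 1 - iid_law mu m B)%E by rewrite probability_setC.
have QE : (iid_law mu m (perturb D @^-1` B) =
    1 - iid_law mu m (perturb D @^-1` (~` B)))%E.
  rewrite -[in LHS](setCK B) preimage_setC probability_setC//.
  exact: measurable_preimage_perturb (measurableC mB).
have [a a0 aE] := fin_iid_law mu mB.
have [b b0 bE] := fin_iid_law mu (measurable_preimage_perturb D (measurableC mB)).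
rewrite PC QE [iid_law mu m B]aE bE invrK.
rewrite -!EFinB -!EFinM -!EFinD !lee_fin => h.
rewrite leNgt; apply/negP => ab.
set s := 2 - tau in s0 si0 h.
have s1 : s^-1 < s.
  have : s^-1 < 1 by rewrite invf_lt1//; rewrite /s; lra.
  by rewrite /s in s0 *; lra.
have e : s * tau + s^-1 * (2 - tau) = 2 - (1 - tau) ^+ 2.
  by rewrite -/s mulVf ?gt_eqF//; rewrite /s; ring.
have : (s - s^-1) * (a + b) <= (s - s^-1) * tau.
  by rewrite ler_wpM2l// ?ltW// subr_gt0.
move: h small e; set S := \sum_(i < m) _; set t := s^-1.
by move=> h small e; nra.
Qed.

(** Le Cam's two-point argument: rejecting f0 when theta is at distance rho or
    more from f0 0 is a test, and when it accepts under f1, theta misses f1 0 by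
    rho at least. *)
Lemma two_point_bound n (f0 f1 : R -> R) (theta : n.*2.+1.-tuple R -> R) (rho tau : R) :
  measurable_fun setT theta -> 0 < tau < 1 -> 2 * rho <= `|f1 0 - f0 0| ->
  M * \sum_(i < n.*2.+1) (f1 (design n (sample_index i)) -
         f0 (design n (sample_index i))) ^+ 2 < (1 - tau) ^+ 2 ->
  ((tau / 2)%:E <= max_error_prob mu f0 f1 theta rho)%E.
Proof.
move=> mtheta tau01 sep small.
pose D (k : nat) := f1 (knot n k.+1) - f0 (knot n k.+1).
pose A := [set y : n.*2.+1.-tuple R | rho <= `|theta y - f0 0|].
have mA c : measurable [set y : n.*2.+1.-tuple R | rho <= `|theta y - c|].
  rewrite (_ : [set _ | _] = (fun y => `|theta y - c|) @^-1` `[rho, +oo[).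
    rewrite -[X in measurable X]setTI; apply: measurableT_comp => //.
    exact: measurable_funB.
  by apply/seteqP; split => y /=; rewrite in_itv/= andbT.
have mB : measurable (@observe R n f0 @^-1` A).
  exact: (measurable_observe_preimage f0 (mA (f0 0))).
have small' : M * \sum_(i < n.*2.+1) D i ^+ 2 < (1 - tau) ^+ 2.
  rewrite (eq_bigr (fun i => (f1 (design n (sample_index i)) -
    f0 (design n (sample_index i))) ^+ 2))// => i _.
  by rewrite /D !design_right.
have := testing_error_ge mB tau01 small'.
have obsE : @observe R n f0 \o perturb D = @observe R n f1.
  apply/funext => e /=; apply: eq_from_tnth => i.
  by rewrite !observeE tnth_mktuple /D; ring.
have -> : perturb D @^-1` (~` (@observe R n f0 @^-1` A)) = @observe R n f1 @^-1` (~` A).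
  by rewrite -obsE.
set P0 := iid_law _ _ _ => h.
rewrite /max_error_prob -/A.
have h1 : (iid_law mu n.*2.+1 (@observe R n f1 @^-1` (~` A)) <=
    data_law mu n f1 [set y | (rho <= `|theta y - f1 0|)%R])%E.
  rewrite data_lawE; apply: le_measure; rewrite ?inE.
  - by apply: measurable_observe_preimage; apply: measurableC; exact: mA.
  - by apply: measurable_observe_preimage; exact: mA.
  - move=> e /= /negP; rewrite -ltNge => lt0.
    have := ler_distD (theta (observe f1 e)) (f1 0) (f0 0).
    by rewrite (distrC (f1 0) (theta _)) => tri; lra.
have {h1}h : (tau%:E <= data_law mu n f0 A +
    data_law mu n f1 [set y | (rho <= `|theta y - f1 0|)%R])%E.
  by apply: (le_trans h); rewrite leeD2l.
set x := data_law mu n f0 A in h *; set z := data_law mu n f1 _ in h *.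
have [hx|hx] := leP (tau / 2)%:E x; first by rewrite le_max hx.
rewrite le_max; apply/orP; right; rewrite leNgt; apply/negP => hz.
have : (x + z < tau%:E)%E by rewrite [tau]splitr EFinD; exact: lteD.
by rewrite ltNge h.
Qed.

End risk_bounds.

Theorem theorem4p2 (R : realType)
  (f0 : R -> R)
  (f0_nd : {in `[-1, 1]%R &, {homo f0 : x y / x <= y}})
  (f0_cont : {for 0, continuous f0})
  (mu : probability R R) (phi : R -> R) (sigma : R)
  (mu_mean : ('E_mu[idfun] = 0)%E)
  (mu_var : ('V_mu[idfun] = (sigma ^+ 2)%:E)%E)
  (mu_density : has_density mu phi)
  (phi_hellinger : exists2 M : R, 0 < M & forall a : R,
     (\int[lebesgue_measure]_y
        ((Num.sqrt (phi (y - a)) - Num.sqrt (phi y)) ^+ 2)%:E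
      <= (M * a ^+ 2)%:E)%E)
  (alpha beta : R)
  (alpha_range : 0 < alpha < 1)
  (beta_range : 0 < beta < 1 / 2) :
  exists2 eta : R, 0 < eta &
  exists (f1 : nat -> R -> R) (gamma : nat -> R),
    [/\ \forall n \near \oo,
          {in `[-1, 1]%R &, {homo f1 n : x y / x <= y}} /\ 0 < gamma n,
        (limn_esup (fun n =>
           max_error_prob mu f0 (f1 n) (fun y : n.*2.+1.-tuple R => fhat y 0)
             (gamma n)) <= alpha%:E)%E &
        (beta%:E < limn_einf (fun n =>
           ereal_inf [set max_error_prob mu f0 (f1 n) theta (eta * gamma n) |
             theta in [set theta : n.*2.+1.-tuple R -> R |
                       measurable_fun setT theta]]))%E].
Proof.
have [M M_gt0 hellinger] := phi_hellinger.
have /andP[alpha0 _] := alpha_range; have /andP[beta0 beta_half] := beta_range.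
(* The minimax risk will be at least tau / 2, and this exceeds beta. *)
pose tau := beta + 1 / 2.
have tau01 : 0 < tau < 1 by rewrite /tau; apply/andP; split; lra.
have K0 : 0 < 4 * (sigma ^+ 2 + 1) / alpha.
  by rewrite divr_gt0// mulr_gt0// ltr_wpDl// sqr_ge0.
pose C := Num.sqrt (4 * (sigma ^+ 2 + 1) / alpha).
have C0 : 0 < C by rewrite sqrtr_gt0.
have C2 : 4 * sigma ^+ 2 / C ^+ 2 <= alpha.
  rewrite ler_pdivrMr ?exprn_gt0// /C sqr_sqrtr ?(ltW K0)//.
  rewrite [leRHS](_ : _ = 4 * (sigma ^+ 2 + 1)); last by field; rewrite gt_eqF.
  by rewrite ler_wpM2l// lerDl.
(* The second bound on c makes M * 4 * c^2 * C^2, hence M times the squared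
   distance, smaller than (1 - tau)^2. *)
pose c := Num.min (1 / 2) ((1 - tau) / (4 * (M + 1) * C)).
have cr : 0 < c <= 1 / 2.
  rewrite ge_min lexx/= andbT lt_min divr_gt0//= divr_gt0//.
    by have /andP[] := tau01; rewrite subr_gt0.
  by rewrite !mulr_gt0// ltr_wpDr// ltW.
have c0 : 0 < c by case/andP: cr.
have small : M * (4 * c ^+ 2 * C ^+ 2) < (1 - tau) ^+ 2.
  have t0 : 0 < 1 - tau by have /andP[] := tau01; rewrite subr_gt0.
  have cC : 4 * (M + 1) * (c * C) <= 1 - tau.
    have : c <= (1 - tau) / (4 * (M + 1) * C) by rewrite ge_min lexx orbT.
    rewrite ler_pdivlMr; last by rewrite !mulr_gt0// ltr_wpDr// ltW.
    by apply: le_trans; rewrite le_eqVlt; apply/orP; left; apply/eqP; ring.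
  have x0 : 0 < c * C by rewrite mulr_gt0.
  rewrite (_ : M * _ = M * 4 * (c * C) ^+ 2); last by ring.
  set x := c * C in cC x0 *.
  have h2 : (4 * (M + 1) * x) ^+ 2 <= (1 - tau) ^+ 2.
    by rewrite ler_pXn2r ?nnegrE ?(ltW t0)// !mulr_ge0 ?addr_ge0 ?ltW.
  apply: lt_le_trans h2.
  rewrite -subr_gt0 (_ : _ - _ = x ^+ 2 * (16 * M ^+ 2 + 28 * M + 16)); last by ring.
  by rewrite mulr_gt0 ?exprn_gt0// !addr_gt0// !mulr_gt0// exprn_gt0.
have [p hp] : {p : nat -> (R -> R) * R &
    forall n, (0 < n)%N -> hard_alternative n C c f0 (p n).1 (p n).2}.
  apply: (@boolp.choice _ _ (fun n q => (0 < n)%N -> hard_alternative n C c f0 q.1 q.2)) => n.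
  have [n0|n0] := ltnP 0 n; last by exists (f0, 0).
  have [f1 [g h]] := exists_hard_alternative n0 C0 cr f0_nd.
  by exists (f1, g).
exists (c / 4); first by rewrite divr_gt0.
exists (fun n => (p n).1), (fun n => (p n).2); split.
- by near=> n; have [|r [l []]//] := hp n; near: n; exists 1%N.
- apply: limn_esup_le => n n0.
  have [r [l [[nd1 g0] acc0 acc1 _ _]]] := hp n n0.
  rewrite ge_max; apply/andP; split.
    apply: (le_trans (fhat_error_bound mu_mean mu_var n0 C0 f0_nd acc0)).
    by rewrite lee_fin.
  apply: (le_trans (fhat_error_bound mu_mean mu_var n0 C0 nd1 acc1)).
  by rewrite lee_fin.
- apply: (@lt_le_trans _ _ (tau / 2)%:E).
    by rewrite lte_fin /tau; lra.
  apply: le_limn_einf => n n0.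
  have [r [l [[nd1 g0] _ _ sep close]]] := hp n n0.
  apply: le_ereal_inf_tmp => _ [theta /= mtheta <-].
  apply: (two_point_bound mu_density M_gt0 hellinger mtheta tau01).
    by move: sep; lra.
  by apply: le_lt_trans small; rewrite ler_wpM2l ?(ltW M_gt0).
Unshelve. all: by end_near.
Qed.
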